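(* Let $\mathcal A=\langle S,T,P\rangle$ be a flat SETA, $m_0$ an initial macro-state, $w_0$ a rational initial energy level, and $L\in\mathbb Q$ a fixed lower bound. (i) It is decidable whether there exists an upper bound $U\in\mathbb Q$ such that there is an infinite run of $\mathcal A$ from $m_0$ with initial energy $w_0$ satisfying the energy constraint $[L;U]$. (ii) If moreover $\mathcal A$ is depth-1 flat, then the least such upper bound $U$ (when one exists) can be computed.
   Context: An energy timed automaton (ETA) is a timed automaton with a finite set of clocks, closed (non-strict) clock constraints as invariants and guards, a rational energy rate $r(s)$ in each state and a rational energy update $u$ on each transition (transitions also reset a set of clocks). During a delay $d\ge0$ in state $s$, clocks increase by $d$, the invariant must hold, and energy increases by $d\cdot r(s)$; a transition requires its guard, resets its clocks and adds $u$ to the energy. An energy constraint is a closed interval $[L;U]$ with rational bounds; a run satisfies it if all energy levels along it lie in it. An energy timed path (ETP) from $s_0$ to $s_n$ is an ETA whose states $s_0,\dots,s_n$ are linked by exactly one transition from $s_i$ to $s_{i+1}$ each. A segmented energy timed automaton (SETA) is a triple $\langle S,T,P\rangle$ where $(S,T)$ is a finite directed graph of macro-states and $P$ maps each edge $(m,m')\in T$ to an ETP with first state $m$ and last state $m'$. A run of a SETA from $m_0$ is a sequence of runs of the ETPs $P(m_0,m_1),P(m_1,m_2),\dots$ along a path of the graph, each starting and ending with all clocks equal to $0$, the final energy of one segment being the initial energy of the next. A SETA is flat if every macro-state belongs to at most one simple cycle of $(S,T)$; it is depth-1 flat if its underlying graph is a tree whose only cycles are self-loops on leaves. *)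

(* Defs.v *)
From Stdlib Require Import Reals QArith Qreals List Arith Relations.
Local Open Scope nat_scope.
Import ListNotations.

Inductive recf : Type :=
| RZero : recf
| RSucc : recf
| RProj : nat -> recf
| RComp : recf -> list recf -> recf
| RPrim : recf -> recf -> recf
| RMu   : recf -> recf.

Inductive eval : recf -> list nat -> nat -> Prop :=
| eZero v : eval RZero v 0
| eSucc x v : eval RSucc (x :: v) (S x)
| eProj (i : nat) v : (i < length v)%nat -> eval (RProj i) v (nth i v 0%nat)
| eComp f gs v ys y : evals gs v ys -> eval f ys y -> eval (RComp f gs) v y
| ePrim0 f g v y : eval f v y -> eval (RPrim f g) (0 :: v) y
| ePrimS f g n v r y :
    eval (RPrim f g) (n :: v) r -> eval g (n :: r :: v) y ->
    eval (RPrim f g) (S n :: v) y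
| eMu f v n :
    eval f (n :: v) 0 ->
    (forall m, (m < n)%nat -> exists k, eval f (m :: v) (S k)) ->
    eval (RMu f) v n
with evals : list recf -> list nat -> list nat -> Prop :=
| evNil v : evals [] v []
| evCons g gs v y ys : eval g v y -> evals gs v ys -> evals (g :: gs) v (y :: ys).

(* Encoding of finite data into natural numbers (Cantor pairing).      *)
Definition cpair (a b : nat) : nat := (a + b) * (a + b + 1) / 2 + b.

Inductive code : Type := CNat (n : nat) | CList (l : list code).

Fixpoint enc_code (c : code) : nat :=
  match c with
  | CNat n => cpair 0 n
  | CList l =>
      cpair 1 ((fix encl (l : list code) : nat :=
                  match l with
                  | [] => 0
                  | x :: r => S (cpair (enc_code x) (encl r))
                  end) l)
  end.

Definition code_Z (z : Z) : code :=
  match z with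
  | Z0 => CList [CNat 0]
  | Zpos p => CList [CNat 1; CNat (Pos.to_nat p)]
  | Zneg p => CList [CNat 2; CNat (Pos.to_nat p)]
  end.

Definition code_Q (q : Q) : code := CList [code_Z (Qnum q); CNat (Pos.to_nat (Qden q))].

Inductive atom : Type :=
| AGe (x : nat) (c : Q)
| ALe (x : nat) (c : Q).

Definition constr := list atom.

Record state : Type := { rate : Q; inv : constr }.
Record trans : Type := { guard : constr; upd : Q; reset : list nat }.

(* An ETP  s_0 -> s_1 -> ... -> s_n : the first state s_0 and last state
   s_n are macro-states (whose data is stored in the SETA); [mids] are the
   intermediate states s_1..s_{n-1}; [trs] are the n transitions. *)
Record etp : Type := { mids : list state; trs : list trans }.

(* A SETA: [nclk] clocks (0..nclk-1), macro-states 0..length mstates - 1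
   with their rate and invariant, and edges (m, m', P(m,m')). *)
Record seta : Type := {
  nclk : nat;
  mstates : list state;
  edges : list (nat * nat * etp)
}.

Definition nms (A : seta) : nat := length (mstates A).

Definition dflt_state : state := {| rate := 0%Q; inv := [] |}.

Definition atom_clock (a : atom) : nat := match a with AGe x _ => x | ALe x _ => x end.
Definition constr_ok (k : nat) (g : constr) : Prop := forall a, In a g -> atom_clock a < k.
Definition state_ok (k : nat) (s : state) : Prop := constr_ok k (inv s).
Definition trans_ok (k : nat) (t : trans) : Prop :=
  constr_ok k (guard t) /\ forall x, In x (reset t) -> x < k.

Definition WF (A : seta) : Prop :=
  (forall s, In s (mstates A) -> state_ok (nclk A) s) /\
  NoDup (map (fun e : nat * nat * etp => (fst (fst e), snd (fst e))) (edges A)) /\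
  (forall m m' p, In (m, m', p) (edges A) ->
     m < nms A /\ m' < nms A /\
     length (trs p) = S (length (mids p)) /\
     (forall s, In s (mids p) -> state_ok (nclk A) s) /\
     (forall t, In t (trs p) -> trans_ok (nclk A) t)).

Definition valuation := nat -> R.

Definition atom_holds (v : valuation) (a : atom) : Prop :=
  match a with
  | AGe x c => Q2R c <= v x
  | ALe x c => v x <= Q2R c
  end%R.

Definition constr_holds (v : valuation) (g : constr) : Prop :=
  forall a, In a g -> atom_holds v a.

Definition delay (v : valuation) (d : R) : valuation := fun x => (v x + d)%R.

Definition reset_val (r : list nat) (v : valuation) : valuation :=
  fun x => if in_dec Nat.eq_dec x r then 0%R else v x.

Fixpoint path_run (k : nat) (L U : R) (sts : list state) (ts : list trans)
    (v : valuation) (w w' : R) : Prop :=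
  match sts, ts with
  | [], [] => w' = w /\ (forall x, x < k -> v x = 0%R)
  | s :: sts', t :: ts' =>
      exists d : R, (0 <= d)%R /\
        (forall t0 : R, (0 <= t0 <= d)%R ->
            constr_holds (delay v t0) (inv s) /\
            (L <= w + t0 * Q2R (rate s) <= U)%R) /\
        constr_holds (delay v d) (guard t) /\
        (L <= w + d * Q2R (rate s) + Q2R (upd t) <= U)%R /\
        path_run k L U sts' ts' (reset_val (reset t) (delay v d))
                 (w + d * Q2R (rate s) + Q2R (upd t))%R w'
  | _, _ => False
  end.

Definition etp_run (A : seta) (L U : R) (m : nat) (p : etp) (w w' : R) : Prop :=
  path_run (nclk A) L U (nth m (mstates A) dflt_state :: mids p) (trs p)
           (fun _ => 0%R) w w'.

Definition inf_run (A : seta) (m0 : nat) (w0 L U : R) : Prop :=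
  exists (ms : nat -> nat) (en : nat -> R),
    ms 0 = m0 /\ en 0 = w0 /\
    forall i, exists p, In (ms i, ms (S i), p) (edges A) /\
                        etp_run A L U (ms i) p (en i) (en (S i)).

Definition good_ub (A : seta) (m0 : nat) (w0 L U : Q) : Prop :=
  inf_run A m0 (Q2R w0) (Q2R L) (Q2R U).

Definition E (A : seta) (m m' : nat) : Prop := exists p, In (m, m', p) (edges A).

Definition simple_cycle (A : seta) (c : list nat) : Prop :=
  c <> [] /\ NoDup c /\
  (forall i, S i < length c -> E A (nth i c 0) (nth (S i) c 0)) /\
  E A (last c 0) (hd 0 c).

Definition rotation (c1 c2 : list nat) : Prop :=
  exists a b, c1 = a ++ b /\ c2 = b ++ a.

Definition flat (A : seta) : Prop :=
  forall v c1 c2, simple_cycle A c1 -> simple_cycle A c2 ->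
    In v c1 -> In v c2 -> rotation c1 c2.

(* Depth-1 flat: apart from self-loops the graph is a (rooted, directed)
   tree, and self-loops only occur on leaves. *)
Definition Enl (A : seta) (m m' : nat) : Prop := E A m m' /\ m <> m'.

Definition depth1_flat (A : seta) : Prop :=
  exists r, r < nms A /\
    (forall m, ~ Enl A m r) /\
    (forall v, v < nms A -> v <> r -> exists! u, Enl A u v) /\
    (forall v, v < nms A -> clos_refl_trans nat (Enl A) r v) /\
    (forall v, E A v v -> forall x, ~ Enl A v x).

Definition code_atom (a : atom) : code :=
  match a with
  | AGe x c => CList [CNat 0; CNat x; code_Q c]
  | ALe x c => CList [CNat 1; CNat x; code_Q c]
  end.
Definition code_constr (g : constr) : code := CList (map code_atom g).
Definition code_state (s : state) : code := CList [code_Q (rate s); code_constr (inv s)].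
Definition code_trans (t : trans) : code :=
  CList [code_constr (guard t); code_Q (upd t); CList (map CNat (reset t))].
Definition code_etp (p : etp) : code :=
  CList [CList (map code_state (mids p)); CList (map code_trans (trs p))].
Definition code_seta (A : seta) : code :=
  CList [CNat (nclk A); CList (map code_state (mstates A));
         CList (map (fun e : nat * nat * etp =>
                       CList [CNat (fst (fst e)); CNat (snd (fst e)); code_etp (snd e)])
                    (edges A))].

Definition enc_input (A : seta) (m0 : nat) (w0 L : Q) : nat :=
  enc_code (CList [code_seta A; CNat m0; code_Q w0; code_Q L]).

Definition enc_Q (q : Q) : nat := enc_code (code_Q q).

(* Main.v *)
Require Import Defs.
From Stdlib Require Import Reals ZArith QArith Qreals List Arith Relations Lia Lra Classical ClassicalEpsilon.
Import ListNotations.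
Local Open Scope nat_scope.

(** The energy relation of an ETP is the projection of a polyhedron, computed by Fourier-Motzkin
    elimination of the delays.  For a loop with relation [F], an infinite iteration from [w] below [U]
    exists iff there are [a <= w <= b] having successors in the interval [a, b]: the infimum and the
    supremum of an infinite run are such [a] and [b] because [F] is closed, and conversely the whole
    interval is stable because [F] is convex.

    When [U] is free, runs are preserved by a simultaneous shift of the energies and of [U].  Hence
    loops that do not increase the energy can be cut out, and one that does can be iterated to reach
    any energy: it is enough to look at paths of length at most the number [N] of macro-states.
    In a flat graph the first-return walks at a vertex are all the same simple cycle, so an infinite
    run is eventually periodic.  In the depth-1 case it is a path of length at most [N] followed by
    one self-loop, and no cutting is needed, so the bound [U] is exact and the least one is found
    among the finitely many vertices of one-dimensional polyhedra.

    Everything is computed by functions on lists, integers and rationals that are shown to be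
    primitive recursive on the codes of their arguments. *)

(** * Primitive recursive functions on codes *)

(** The upper bound stays a free variable of every system of constraints, so one system per path
    serves all bounds at once. Since [L] is fixed and [U] may grow, energies can only be shifted
    upwards, and the initial energy [w0] is the one value that cannot be shifted at all. This is why
    a gaining loop reached from [w0] has to be kept. Once it is there, the energy at which the rest
    of the path starts no longer has to match the energy at the end of the loop, because repetitions
    supply any amount; forgetting this link is what makes the search finite although the number of
    repetitions has no bound known in advance. A strict gain cannot be expressed by non-strict
    inequalities. It is found by minimizing the opposite of the gain, bounded below by -1 so that
    the minimum exists, and testing its sign. Cutting and boosting may raise [U], so they decide
    existence without giving the least bound. *)

Definition fn (k : nat) (f : list nat -> nat) : Prop :=
  exists c, forall v, length v = k -> eval c v (f v).

Lemma fn_ext k f g : (forall v, length v = k -> f v = g v) -> fn k f -> fn k g.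
Proof. intros H [c Hc]. exists c. intros v Hv. rewrite <- H; auto. Qed.

Lemma fn_proj k i : i < k -> fn k (fun v => nth i v 0).
Proof. intros H. exists (RProj i). intros v Hv. constructor. lia. Qed.

Lemma fn_projs k gs : Forall (fn k) gs ->
  exists cs, forall v, length v = k -> evals cs v (map (fun g => g v) gs).
Proof.
  induction 1 as [|g gs [c Hc] _ [cs Hcs]].
  - exists []. intros. constructor.
  - exists (c :: cs). intros. simpl. constructor; auto.
Qed.

Lemma fn_comp k f gs : fn (length gs) f -> Forall (fn k) gs ->
  fn k (fun v => f (map (fun g => g v) gs)).
Proof.
  intros [c Hc] H. destruct (fn_projs _ _ H) as [cs Hcs].
  exists (RComp c cs). intros v Hv. eapply eComp; eauto.
  apply Hc. now rewrite length_map.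
Qed.

Lemma fn_app1 k f g : fn 1 (fun v => f (nth 0 v 0)) -> fn k g -> fn k (fun v => f (g v)).
Proof. intros Hf Hg. exact (fn_comp k _ [g] Hf (Forall_cons _ Hg (Forall_nil _))). Qed.

Lemma fn_app2 k f g h : fn 2 (fun v => f (nth 0 v 0) (nth 1 v 0)) ->
  fn k g -> fn k h -> fn k (fun v => f (g v) (h v)).
Proof.
  intros Hf Hg Hh.
  exact (fn_comp k _ [g; h] Hf (Forall_cons _ Hg (Forall_cons _ Hh (Forall_nil _)))).
Qed.

Lemma fn_S k g : fn k g -> fn k (fun v => S (g v)).
Proof.
  apply (fn_app1 k S). exists RSucc. intros [|x [|? ?]] Hv; try discriminate. constructor.
Qed.

Lemma fn_const k n : fn k (fun _ => n).
Proof.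
  induction n.
  - exists RZero. intros; constructor.
  - now apply (fn_S k (fun _ => n)).
Qed.

Lemma fn_ids k : exists cs, forall v, length v = k -> evals cs v v.
Proof.
  destruct (fn_projs k (map (fun i v => nth i v 0) (seq 0 k))) as [cs Hcs].
  - apply Forall_forall. intros f Hf. apply in_map_iff in Hf as [i [<- Hi]].
    apply in_seq in Hi. apply fn_proj. lia.
  - exists cs. intros v Hv. specialize (Hcs v Hv). rewrite map_map in Hcs.
    replace (map (fun x => nth x v 0) (seq 0 k)) with v in Hcs; auto.
    subst k. clear. induction v; simpl; auto. f_equal.
    rewrite <- seq_shift, map_map. exact IHv.
Qed.

Lemma fn_rec k b s n : fn k b -> fn (S (S k)) (fun v => s (nth 0 v 0) (nth 1 v 0) (tl (tl v))) ->
  fn k n -> fn k (fun v => nat_rect (fun _ => nat) (b v) (fun m r => s m r v) (n v)).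
Proof.
  intros [cb Hb] [cs Hs] [cn Hn]. destruct (fn_ids k) as [ids Hids].
  (* The recursion argument is computed in front of a full copy of [v], which projections rebuild;
     all of [v] then serves as the parameters of [RPrim]. *)
  exists (RComp (RPrim cb cs) (cn :: ids)). intros v Hv.
  eapply eComp. { constructor; eauto. }
  generalize (n v). intros j. induction j; simpl.
  - constructor. auto.
  - eapply ePrimS; eauto. apply (Hs (j :: _ :: v)). simpl; auto.
Qed.

Lemma fn_tt k i : i < k -> fn (S (S k)) (fun v => nth i (tl (tl v)) 0).
Proof.
  intros H. eapply fn_ext; [|apply (fn_proj _ (S (S i))); lia].
  intros [|a [|b v]]; simpl; intros; try discriminate; reflexivity.
Qed.

Lemma fn_ttcomp k f : fn k f -> fn (S (S k)) (fun v => f (tl (tl v))).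
Proof.
  intros [c Hc]. 
  destruct (fn_projs (S (S k)) (map (fun i v => nth i (tl (tl v)) 0) (seq 0 k))) as [cs Hcs].
  - apply Forall_forall. intros g Hf. apply in_map_iff in Hf as [i [<- Hi]].
    apply in_seq in Hi. apply fn_tt. lia.
  - exists (RComp c cs). intros v Hv. eapply eComp; [apply Hcs; auto|].
    rewrite map_map. destruct v as [|x [|y v]]; try discriminate. simpl in *.
    injection Hv as Hv.
    replace (map (fun x => nth x v 0) (seq 0 k)) with v; auto.
    clear -Hv. subst k. induction v; simpl; auto. f_equal.
    rewrite <- seq_shift, map_map. exact IHv.
Qed.

Lemma fn_pred k g : fn k g -> fn k (fun v => pred (g v)).
Proof.
  intros Hg. eapply fn_ext; [|apply (fn_rec k (fun _ => 0) (fun m _ _ => m) g); auto using fn_const].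
  - intros v _. simpl. destruct (g v); reflexivity.
  - apply fn_proj. lia.
Qed.

Lemma fn_add k g h : fn k g -> fn k h -> fn k (fun v => g v + h v).
Proof.
  intros Hg Hh. eapply fn_ext; [|apply (fn_rec k h (fun _ r _ => S r) g); auto].
  - intros v _. simpl. induction (g v); simpl; auto.
  - apply fn_S, fn_proj. lia.
Qed.

Lemma fn_sub k g h : fn k g -> fn k h -> fn k (fun v => g v - h v).
Proof.
  intros Hg Hh. eapply fn_ext; [|apply (fn_rec k g (fun _ r _ => pred r) h); auto].
  - intros v _. simpl. induction (h v); simpl; lia.
  - apply fn_pred, fn_proj. lia.
Qed.

Lemma fn_mul k g h : fn k g -> fn k h -> fn k (fun v => g v * h v).
Proof.
  intros Hg Hh. eapply fn_ext; [|apply (fn_rec k (fun _ => 0) (fun _ r v => h v + r) g); auto using fn_const].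
  - intros v _. simpl. induction (g v); simpl; auto.
  - apply fn_add; [now apply fn_ttcomp | apply fn_proj; lia].
Qed.

Definition ifz (a b c : nat) := match a with 0 => b | S _ => c end.

Lemma fn_ifz k f g h : fn k f -> fn k g -> fn k h -> fn k (fun v => ifz (f v) (g v) (h v)).
Proof.
  intros Hf Hg Hh. eapply fn_ext; [|apply (fn_rec k g (fun _ _ v => h v) f); auto].
  - intros v _. simpl. destruct (f v); reflexivity.
  - now apply fn_ttcomp.
Qed.

(** * Cantor pairing and its inverse *)

Definition tri (n : nat) := nat_rect (fun _ => nat) 0 (fun m r => r + S m) n.

Lemma fn_tri k g : fn k g -> fn k (fun v => tri (g v)).
Proof.
  intros Hg. apply (fn_rec k (fun _ => 0) (fun m r _ => r + S m) g); auto using fn_const.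
  apply fn_add; [|apply fn_S]; apply fn_proj; lia.
Qed.

Lemma tri_double n : 2 * tri n = n * (n + 1).
Proof. induction n; [reflexivity|]. change (tri (S n)) with (tri n + S n). lia. Qed.

Lemma cpair_tri a b : cpair a b = tri (a + b) + b.
Proof.
  unfold cpair. f_equal. symmetry.
  apply Nat.div_unique with 0; [lia|]. rewrite tri_double. lia.
Qed.

Lemma fn_cpair k g h : fn k g -> fn k h -> fn k (fun v => cpair (g v) (h v)).
Proof.
  intros Hg Hh. apply fn_ext with (fun v => tri (g v + h v) + h v).
  - intros; now rewrite cpair_tri.
  - auto using fn_add, fn_tri.
Qed.

(** The diagonal of the Cantor enumeration on which [z] lies, that is, the largest [s] with
    [tri s <= z]. Passing from [z] to [S z] changes it by at most one, so primitive recursion on [z]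
    finds it. *)
Definition root (z : nat) := nat_rect (fun _ => nat) 0
  (fun m s => ifz (tri (S s) - S m) (S s) s) z.
Definition pi2 z := z - tri (root z).
Definition pi1 z := root z - pi2 z.

Lemma fn_root k g : fn k g -> fn k (fun v => root (g v)).
Proof.
  intros Hg.
  apply (fn_rec k (fun _ => 0) (fun m s _ => ifz (tri (S s) - S m) (S s) s) g);
    auto using fn_const.
  apply fn_ifz; [apply fn_sub; [apply fn_tri|]| |];
   repeat apply fn_S; apply fn_proj; lia.
Qed.
Lemma fn_pi2 k g : fn k g -> fn k (fun v => pi2 (g v)).
Proof. intros. unfold pi2. auto using fn_sub, fn_tri, fn_root. Qed.
Lemma fn_pi1 k g : fn k g -> fn k (fun v => pi1 (g v)).
Proof. intros. unfold pi1. auto using fn_sub, fn_pi2, fn_root. Qed.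

Lemma root_spec z : tri (root z) <= z < tri (S (root z)).
Proof.
  induction z; [simpl; lia|].
  change (root (S z)) with (ifz (tri (S (root z)) - S z) (S (root z)) (root z)).
  set (s := root z) in *. change (tri (S s)) with (tri s + S s) in *.
  destruct (tri s + S s - S z) eqn:H.
  - change (tri (S (S s))) with (tri s + S s + S (S s)). change (tri (S s)) with (tri s + S s). simpl. lia.
  - change (tri s <= S z < tri s + S s). lia.
Qed.

Lemma tri_mono a b : a <= b -> tri a <= tri b.
Proof. induction 1; auto. change (tri (S m)) with (tri m + S m). lia. Qed.

Lemma root_cpair a b : root (cpair a b) = a + b.
Proof.
  rewrite cpair_tri. pose proof (root_spec (tri (a + b) + b)) as H.
  set (s := root _) in *. change (tri (S s)) with (tri s + S s) in H.
  destruct (lt_eq_lt_dec s (a + b)) as [[Hl|]|Hl]; auto.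
  - pose proof (tri_mono (S s) (a + b) Hl). change (tri (S s)) with (tri s + S s) in H0. lia.
  - pose proof (tri_mono (S (a + b)) s Hl). change (tri (S (a + b))) with (tri (a + b) + S (a + b)) in H0. lia.
Qed.

Lemma pi2_cpair a b : pi2 (cpair a b) = b.
Proof. unfold pi2. rewrite root_cpair, cpair_tri. lia. Qed.
Lemma pi1_cpair a b : pi1 (cpair a b) = a.
Proof. unfold pi1. rewrite pi2_cpair, root_cpair. lia. Qed.

Lemma cpair_ge a b : a <= cpair a b /\ b <= cpair a b.
Proof.
  rewrite cpair_tri. assert (forall n, n <= tri n).
  { induction n; auto. change (tri (S n)) with (tri n + S n). lia. }
  specialize (H (a + b)). lia.
Qed.

(** A name for the anonymous fixpoint nested in [enc_code]; [enc_CList] then holds by conversion. *)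
Fixpoint encl (l : list code) : nat :=
  match l with [] => 0 | x :: r => S (cpair (enc_code x) (encl r)) end.

Lemma enc_CList l : enc_code (CList l) = cpair 1 (encl l).
Proof. reflexivity. Qed.

(** * Computable functions between encoded types *)

Class Codable (A : Type) := tocode : A -> code.
Definition enc {A} `{Codable A} (a : A) : nat := enc_code (tocode a).

#[global] Instance Codable_nat : Codable nat := CNat.
#[global] Instance Codable_bool : Codable bool := fun b => CNat (if b then 1 else 0).
#[global] Instance Codable_Z : Codable Z := code_Z.
#[global] Instance Codable_positive : Codable positive := fun p => CNat (Pos.to_nat p).
#[global] Instance Codable_Q : Codable Q := code_Q.
#[global] Instance Codable_prod A B `{Codable A} `{Codable B} : Codable (A * B) :=
  fun p => CList [tocode (fst p); tocode (snd p)].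
#[global] Instance Codable_list A `{Codable A} : Codable (list A) :=
  fun l => CList (map tocode l).

(** Tracking on codes: [g] has to agree with [f] only on numbers that encode an element, and is
    total but arbitrary elsewhere. *)
Inductive Cmp {A B} `{Codable A} `{Codable B} (f : A -> B) : Prop :=
  Cmp_intro (g : nat -> nat) :
    fn 1 (fun v => g (nth 0 v 0)) /\ (forall a, g (enc a) = enc (f a)) -> Cmp f.

Section Closure.
Context {X A B : Type} `{Codable X} `{Codable A} `{Codable B}.

Lemma Cmp_ext (f g : X -> A) : (forall x, f x = g x) -> Cmp f -> Cmp g.
Proof. intros E [h [Hh Hf]]. exists h. split; auto. intros a. now rewrite Hf, E. Qed.

Lemma Cmp_id : Cmp (fun x : X => x).
Proof. exists (fun x => x). split; auto. apply fn_proj; lia. Qed.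

Lemma Cmp_const (a : A) : Cmp (fun _ : X => a).
Proof. exists (fun _ => enc a). split; auto. apply fn_const. Qed.

Lemma Cmp_comp (f : A -> B) (g : X -> A) : Cmp f -> Cmp g -> Cmp (fun x => f (g x)).
Proof.
  intros [f' [Hf Ef]] [g' [Hg Eg]]. exists (fun x => f' (g' x)). split.
  - now apply (fn_app1 1 f' (fun v => g' (nth 0 v 0))).
  - intros. now rewrite Eg, Ef.
Qed.

Lemma Cmp_pair (f : X -> A) (g : X -> B) : Cmp f -> Cmp g -> Cmp (fun x => (f x, g x)).
Proof.
  intros [f' [Hf Ef]] [g' [Hg Eg]].
  exists (fun x => cpair 1 (S (cpair (f' x) (S (cpair (g' x) 0))))). split.
  - repeat first [apply fn_cpair | apply fn_S | apply fn_const | assumption].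
  - intros. now rewrite Ef, Eg.
Qed.
End Closure.

Fixpoint item (i : nat) (z : nat) : nat :=
  match i with 0 => pi1 (pred z) | S i => item i (pi2 (pred z)) end.

Lemma fn_item i k g : fn k g -> fn k (fun v => item i (g v)).
Proof.
  revert g. induction i; simpl; intros g Hg.
  - auto using fn_pi1, fn_pred.
  - apply (IHi (fun v => pi2 (pred (g v)))). auto using fn_pi2, fn_pred.
Qed.

Lemma item_encl i l d : i < length l -> item i (encl l) = enc_code (nth i l d).
Proof.
  revert l. induction i; intros [|c l] Hi; simpl in Hi; try lia; simpl.
  - now rewrite pi1_cpair.
  - rewrite pi2_cpair. apply IHi. lia.
Qed.

(** Covers every record projection at once: a field is an entry at a fixed position of the encoded
    list. *)
Lemma Cmp_item {A B} `{Codable A} `{Codable B} (f : A -> B) (i : nat) (l : A -> list code) :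
  (forall a, tocode a = CList (l a)) ->
  (forall a, nth_error (l a) i = Some (tocode (f a))) -> Cmp f.
Proof.
  intros E1 E2. exists (fun z => item i (pi2 z)). split.
  - apply (fn_item i 1 (fun v => pi2 (nth 0 v 0))), fn_pi2, fn_proj. lia.
  - intros a. unfold enc at 1. rewrite E1, enc_CList, pi2_cpair.
    rewrite (item_encl _ _ (tocode (f a))).
    + specialize (E2 a). eapply nth_error_nth in E2. now rewrite E2.
    + apply nth_error_Some. now rewrite E2.
Qed.

Section Closure2.
Context {X A B : Type} `{Codable X} `{Codable A} `{Codable B}.

Lemma Cmp_fst (f : X -> A * B) : Cmp f -> Cmp (fun x => fst (f x)).
Proof.
  apply (Cmp_comp fst). now apply Cmp_item with 0 (fun p => [tocode (fst p); tocode (snd p)]).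
Qed.
Lemma Cmp_snd (f : X -> A * B) : Cmp f -> Cmp (fun x => snd (f x)).
Proof.
  apply (Cmp_comp snd). now apply Cmp_item with 1 (fun p => [tocode (fst p); tocode (snd p)]).
Qed.

Lemma Cmp_if (b : X -> bool) (f g : X -> A) :
  Cmp b -> Cmp f -> Cmp g -> Cmp (fun x => if b x then f x else g x).
Proof.
  intros [b' [Hb Eb]] [f' [Hf Ef]] [g' [Hg Eg]].
  (* [pi2] strips the tag of [CNat]; [ifz] takes its zero case first and [false] is coded by 0,
     hence the swapped branches. *)
  exists (fun x => ifz (pi2 (b' x)) (g' x) (f' x)). split.
  - apply fn_ifz; auto. now apply fn_pi2.
  - intros a. rewrite Eb, Ef, Eg. change (enc (b a)) with (cpair 0 (if b a then 1 else 0)).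
    rewrite pi2_cpair. now destruct (b a).
Qed.

Lemma Cmp_nat_rect (b : X -> A) (s : X -> nat -> A -> A) (n : X -> nat) :
  Cmp b -> Cmp (fun p : X * nat * A => s (fst (fst p)) (snd (fst p)) (snd p)) -> Cmp n ->
  Cmp (fun x => nat_rect (fun _ => A) (b x) (s x) (n x)).
Proof.
  intros [b' [Hb Eb]] [s' [Hs Es]] [n' [Hn En]].
  (* [pr] and [cpair 0] mimic the encodings of pairs and naturals, so [pr (pr x (cpair 0 m)) r] is
     the code of the triple [(x, m, r)]. *)
  set (pr a b := cpair 1 (S (cpair a (S (cpair b 0))))).
  exists (fun x => nat_rect (fun _ => nat) (b' x) (fun m r => s' (pr (pr x (cpair 0 m)) r)) (pi2 (n' x))).
  split.
  - apply (fn_rec 1 (fun v => b' (nth 0 v 0))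
      (fun m r v => s' (pr (pr (nth 0 v 0) (cpair 0 m)) r)) (fun v => pi2 (n' (nth 0 v 0)))); auto.
    + apply (fn_app1 3 s'); auto. unfold pr.
      repeat first [apply fn_cpair | apply fn_S | apply fn_const | apply fn_tt; lia | apply fn_proj; lia].
    + now apply fn_pi2.
  - intros x. rewrite Eb, En. change (enc (n x)) with (cpair 0 (n x)). rewrite pi2_cpair.
    induction (n x); simpl; auto. rewrite IHn0. apply (Es (x, n0, _)).
Qed.

Lemma enc_list_cons (a : A) l : enc (a :: l) = cpair 1 (S (cpair (enc a) (pi2 (enc l)))).
Proof. unfold enc at 1. simpl tocode. unfold tocode at 1, Codable_list. rewrite enc_CList. simpl.
  unfold enc. unfold tocode at 4. unfold Codable_list. now rewrite enc_CList, pi2_cpair. Qed.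

Lemma Cmp_cons (f : X -> A) (g : X -> list A) : Cmp f -> Cmp g -> Cmp (fun x => f x :: g x).
Proof.
  intros [f' [Hf Ef]] [g' [Hg Eg]].
  exists (fun x => cpair 1 (S (cpair (f' x) (pi2 (g' x))))). split.
  - repeat first [apply fn_cpair | apply fn_S | apply fn_pi2 | apply fn_const | assumption].
  - intros. now rewrite Ef, Eg, enc_list_cons.
Qed.

(* The state is the pair (raw rest of the list, accumulator); the code of a list bounds its length,
   and steps past its end do nothing. *)
Lemma Cmp_fold_left (s : X -> B -> A -> B) (l : X -> list A) (b : X -> B) :
  Cmp (fun p : X * B * A => s (fst (fst p)) (snd (fst p)) (snd p)) -> Cmp l -> Cmp b ->
  Cmp (fun x => fold_left (s x) (l x) (b x)).
Proof.
  intros [s' [Hs Es]] [l' [Hl El]] [b' [Hb Eb]].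
  set (pr a b := cpair 1 (S (cpair a (S (cpair b 0))))).
  set (stp (m r x : nat) := ifz (pi1 r) r
         (cpair (pi2 (pred (pi1 r))) (s' (pr (pr x (pi2 r)) (pi1 (pred (pi1 r))))))).
  exists (fun x => pi2 (nat_rect (fun _ => nat) (cpair (pi2 (l' x)) (b' x))
                     (fun m r => stp m r x) (l' x))).
  split.
  - apply fn_pi2, (fn_rec 1 (fun v => cpair (pi2 (l' (nth 0 v 0))) (b' (nth 0 v 0)))
      (fun m r v => stp m r (nth 0 v 0)) (fun v => l' (nth 0 v 0))); auto.
    + apply fn_cpair; auto. now apply fn_pi2.
    + unfold stp. assert (fn 3 (fun v => nth 1 v 0)) by (apply fn_proj; lia).
      apply fn_ifz; [now apply fn_pi1|auto|].
      apply fn_cpair; [now apply fn_pi2, fn_pred, fn_pi1|].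
      apply (fn_app1 3 s'); auto. unfold pr.
      repeat first [assumption | apply fn_cpair | apply fn_S | apply fn_const | apply fn_pi2
        | apply fn_pi1 | apply fn_pred | apply fn_tt; lia].
  - intros x. rewrite El, Eb.
    assert (Hlen : forall (k : list A), length k <= enc k).
    { induction k; simpl; [lia|]. rewrite enc_list_cons.
      pose proof (cpair_ge 1 (S (cpair (enc a) (pi2 (enc k))))).
      pose proof (cpair_ge (enc a) (pi2 (enc k))).
      assert (length k <= pi2 (enc k)).
      { clear. unfold enc, tocode, Codable_list. rewrite enc_CList, pi2_cpair.
        induction k; simpl; auto.
        pose proof (cpair_ge (enc_code (H0 a)) (encl (map H0 k))). simpl in *. 
        unfold tocode in *. lia. }
      lia. }
    assert (Hit : forall n (k : list A) acc, length k <= n ->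
      nat_rect (fun _ => nat) (cpair (pi2 (enc k)) (enc acc)) (fun m r => stp m r (enc x)) n =
      cpair 0 (enc (fold_left (s x) k acc))).
    (* [nat_rect] exposes the last iteration, while the list is consumed from its head; the first
       iteration can be peeled off instead because [stp] ignores its counter. *)
    { assert (Hsh : forall n z, nat_rect (fun _ => nat) z (fun m r => stp m r (enc x)) (S n) =
        nat_rect (fun _ => nat) (stp 0 z (enc x)) (fun m r => stp m r (enc x)) n).
      { induction n; intros z; [reflexivity|].
        exact (f_equal (fun r => stp n r (enc x)) (IHn z)). }
      induction n; intros k acc Hk.
      - destruct k; [reflexivity|simpl in Hk; lia].
      - rewrite Hsh. destruct k as [|a k].
        + unfold stp at 1. rewrite pi1_cpair. simpl length in *.
          apply (IHn [] acc). simpl. lia.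
        + simpl fold_left. rewrite <- IHn by (simpl in Hk; lia). f_equal.
          unfold stp. rewrite enc_list_cons. rewrite !pi1_cpair, !pi2_cpair. simpl ifz.
          simpl pred. rewrite pi1_cpair, pi2_cpair. f_equal. apply (Es (x, acc, a)). }
    rewrite Hit by auto. apply pi2_cpair.
Qed.
End Closure2.

(** * List functions *)

Section Lists.
Context {X A B : Type} `{Codable X} `{Codable A} `{Codable B}.

Lemma Cmp_rev (l : X -> list A) : Cmp l -> Cmp (fun x => rev (l x)).
Proof.
  intros Hl. apply Cmp_ext with (fun x => fold_left (fun acc a => a :: acc) (l x) []).
  - intros x. rewrite <- fold_left_rev_right.
    transitivity (rev (l x) ++ []); [|apply app_nil_r].
    induction (rev (l x)); simpl; congruence.
  - apply (Cmp_fold_left (fun _ acc a => a :: acc) l (fun _ => [])); auto using Cmp_const.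
    apply Cmp_cons; [apply Cmp_snd, Cmp_id | apply Cmp_snd, Cmp_fst, Cmp_id].
Qed.

Lemma Cmp_fold_right (s : X -> A -> B -> B) (l : X -> list A) (b : X -> B) :
  Cmp (fun p : X * A * B => s (fst (fst p)) (snd (fst p)) (snd p)) -> Cmp l -> Cmp b ->
  Cmp (fun x => fold_right (s x) (b x) (l x)).
Proof.
  intros Hs Hl Hb. apply Cmp_ext with (fun x => fold_left (fun acc a => s x a acc) (rev (l x)) (b x)).
  - intros x. now rewrite <- fold_left_rev_right, rev_involutive.
  - apply (Cmp_fold_left (fun x acc a => s x a acc) (fun x => rev (l x)) b); auto using Cmp_rev.
    apply (Cmp_comp (fun p : X * A * B => s (fst (fst p)) (snd (fst p)) (snd p))
             (fun q : X * B * A => (fst (fst q), snd q, snd (fst q)))); auto.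
    repeat apply Cmp_pair; repeat (apply Cmp_fst || apply Cmp_snd); apply Cmp_id.
Qed.
End Lists.

Section Lists2.
Context {X A B : Type} `{Codable X} `{Codable A} `{Codable B}.

Lemma Cmp_app (f g : X -> list A) : Cmp f -> Cmp g -> Cmp (fun x => f x ++ g x).
Proof.
  intros Hf Hg. apply Cmp_ext with (fun x => fold_right (fun a r => a :: r) (g x) (f x)).
  - intros x. induction (f x); simpl; congruence.
  - apply (Cmp_fold_right (fun _ a r => a :: r) f g); auto.
    apply Cmp_cons; [apply Cmp_snd, Cmp_fst, Cmp_id | apply Cmp_snd, Cmp_id].
Qed.

End Lists2.
Section Lists3.
Context {X A B : Type} `{Codable X} `{Codable A} `{Codable B}.

Lemma Cmp_flat_map (f : X -> A -> list B) (l : X -> list A) :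
  Cmp (fun p : X * A => f (fst p) (snd p)) -> Cmp l -> Cmp (fun x => flat_map (f x) (l x)).
Proof.
  intros Hf Hl. apply Cmp_ext with (fun x => fold_right (fun a r => f x a ++ r) [] (l x)).
  - intros x. induction (l x); simpl; now rewrite ?IHl0.
  - apply (Cmp_fold_right (fun x a r => f x a ++ r) l (fun _ => [])); auto using Cmp_const.
    apply Cmp_app; [|apply Cmp_snd, Cmp_id].
    apply (Cmp_comp (fun p : X * A => f (fst p) (snd p)) (fun q : X * A * list B => fst q)); auto.
    apply Cmp_fst, Cmp_id.
Qed.

Lemma Cmp_map (f : X -> A -> B) (l : X -> list A) :
  Cmp (fun p : X * A => f (fst p) (snd p)) -> Cmp l -> Cmp (fun x => map (f x) (l x)).
Proof.
  intros Hf Hl. apply Cmp_ext with (fun x => flat_map (fun a => [f x a]) (l x)).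
  - intros x. induction (l x); simpl; now rewrite ?IHl0.
  - apply (Cmp_flat_map (fun x a => [f x a])); auto. apply Cmp_cons; auto using Cmp_const.
Qed.

Lemma Cmp_filter (f : X -> A -> bool) (l : X -> list A) :
  Cmp (fun p : X * A => f (fst p) (snd p)) -> Cmp l -> Cmp (fun x => filter (f x) (l x)).
Proof.
  intros Hf Hl.
  apply Cmp_ext with (fun x => fold_right (fun a r => if f x a then a :: r else r) [] (l x)).
  - intros x. induction (l x); simpl; now rewrite ?IHl0.
  - apply (Cmp_fold_right (fun x a r => if f x a then a :: r else r) l (fun _ => [])); auto using Cmp_const.
    apply Cmp_if.
    + apply (Cmp_comp (fun p : X * A => f (fst p) (snd p)) (fun q : X * A * list A => fst q)); auto.
      apply Cmp_fst, Cmp_id.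
    + apply Cmp_cons; [apply Cmp_snd, Cmp_fst, Cmp_id | apply Cmp_snd, Cmp_id].
    + apply Cmp_snd, Cmp_id.
Qed.

Lemma Cmp_existsb (f : X -> A -> bool) (l : X -> list A) :
  Cmp (fun p : X * A => f (fst p) (snd p)) -> Cmp l -> Cmp (fun x => existsb (f x) (l x)).
Proof.
  intros Hf Hl.
  apply Cmp_ext with (fun x => fold_right (fun a r => if f x a then true else r) false (l x)).
  - intros x. induction (l x); simpl; now rewrite ?IHl0.
  - apply (Cmp_fold_right (fun x a r => if f x a then true else r) l (fun _ => false)); auto using Cmp_const.
    apply Cmp_if; [|apply Cmp_const|apply Cmp_snd, Cmp_id].
    apply (Cmp_comp (fun p : X * A => f (fst p) (snd p)) (fun q : X * A * bool => fst q)); auto.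
    apply Cmp_fst, Cmp_id.
Qed.

Lemma Cmp_forallb (f : X -> A -> bool) (l : X -> list A) :
  Cmp (fun p : X * A => f (fst p) (snd p)) -> Cmp l -> Cmp (fun x => forallb (f x) (l x)).
Proof.
  intros Hf Hl.
  apply Cmp_ext with (fun x => fold_right (fun a r => if f x a then r else false) true (l x)).
  - intros x. induction (l x); simpl; now rewrite ?IHl0.
  - apply (Cmp_fold_right (fun x a r => if f x a then r else false) l (fun _ => true)); auto using Cmp_const.
    apply Cmp_if; [|apply Cmp_snd, Cmp_id|apply Cmp_const].
    apply (Cmp_comp (fun p : X * A => f (fst p) (snd p)) (fun q : X * A * bool => fst q)); auto.
    apply Cmp_fst, Cmp_id.
Qed.

Lemma Cmp_length (l : X -> list A) : Cmp l -> Cmp (fun x => length (l x)).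
Proof.
  intros Hl. apply Cmp_ext with (fun x => fold_right (fun _ r => S r) 0 (l x)).
  - intros x. induction (l x); simpl; now rewrite ?IHl0.
  - apply (Cmp_fold_right (fun _ _ r => S r) l (fun _ => 0)); auto using Cmp_const.
    apply (Cmp_comp S (fun p => snd p)); [|apply Cmp_snd, Cmp_id].
    exists (fun z => cpair 0 (S (pi2 z))). split.
    + apply fn_cpair; [apply fn_const|]. apply fn_S, fn_pi2, fn_proj. lia.
    + intros n. change (enc n) with (cpair 0 n). now rewrite pi2_cpair.
Qed.
End Lists3.
Lemma Cmp_nat1 {X} `{Codable X} (f : nat -> nat) (g : X -> nat) :
  fn 1 (fun v => f (nth 0 v 0)) -> Cmp g -> Cmp (fun x => f (g x)).
Proof.
  intros Hf. apply (Cmp_comp f). exists (fun z => cpair 0 (f (pi2 z))). split.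
  - apply fn_cpair; [apply fn_const|].
    apply (fn_app1 1 f (fun v => pi2 (nth 0 v 0))); auto. apply fn_pi2, fn_proj. lia.
  - intros n. change (enc n) with (cpair 0 n). now rewrite pi2_cpair.
Qed.

Lemma Cmp_nat2 {X} `{Codable X} (f : nat -> nat -> nat) (g h : X -> nat) :
  fn 2 (fun v => f (nth 0 v 0) (nth 1 v 0)) -> Cmp g -> Cmp h -> Cmp (fun x => f (g x) (h x)).
Proof.
  intros Hf [g' [Hg Eg]] [h' [Hh Eh]].
  exists (fun z => cpair 0 (f (pi2 (g' z)) (pi2 (h' z)))). split.
  - apply fn_cpair; [apply fn_const|].
    apply (fn_app2 1 f (fun v => pi2 (g' (nth 0 v 0))) (fun v => pi2 (h' (nth 0 v 0))));
      auto using fn_pi2.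
  - intros x. rewrite Eg, Eh. change (enc (g x)) with (cpair 0 (g x)).
    change (enc (h x)) with (cpair 0 (h x)). now rewrite !pi2_cpair.
Qed.

Lemma Cmp_nat2_bool {X} `{Codable X} (f : nat -> nat -> bool) (g h : X -> nat) :
  fn 2 (fun v => if f (nth 0 v 0) (nth 1 v 0) then 1 else 0) -> Cmp g -> Cmp h ->
  Cmp (fun x => f (g x) (h x)).
Proof.
  intros Hf Hg Hh.
  destruct (Cmp_nat2 (fun a b => if f a b then 1 else 0) g h Hf Hg Hh) as [k [Hk Ek]].
  now exists k.
Qed.

Create HintDb cmp discriminated.
#[global] Hint Constants Opaque : cmp.
#[global] Hint Resolve Cmp_id Cmp_const Cmp_pair Cmp_fst Cmp_snd Cmp_if Cmp_nat_rect Cmp_cons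
  Cmp_fold_left Cmp_fold_right Cmp_rev Cmp_app Cmp_flat_map Cmp_map Cmp_filter Cmp_existsb
  Cmp_forallb Cmp_length : cmp.

Ltac cmp := eauto 100 with cmp nocore.
Ltac fn_proj := apply fn_proj; lia.

(** * Arithmetic on naturals and list lookup *)

Section NatOps.
Context {X : Type} `{Codable X}.

Lemma Cmp_S (g : X -> nat) : Cmp g -> Cmp (fun x => S (g x)).
Proof. apply Cmp_nat1, fn_S. fn_proj. Qed.
Lemma Cmp_add (g h : X -> nat) : Cmp g -> Cmp h -> Cmp (fun x => g x + h x).
Proof. apply (Cmp_nat2 Nat.add), fn_add; fn_proj. Qed.
Lemma Cmp_sub (g h : X -> nat) : Cmp g -> Cmp h -> Cmp (fun x => g x - h x).
Proof. apply (Cmp_nat2 Nat.sub), fn_sub; fn_proj. Qed.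
Lemma Cmp_mul (g h : X -> nat) : Cmp g -> Cmp h -> Cmp (fun x => g x * h x).
Proof. apply (Cmp_nat2 Nat.mul), fn_mul; fn_proj. Qed.

Lemma Cmp_leb (g h : X -> nat) : Cmp g -> Cmp h -> Cmp (fun x => g x <=? h x).
Proof.
  apply (Cmp_nat2_bool Nat.leb).
  apply fn_ext with (fun v => ifz (nth 0 v 0 - nth 1 v 0) 1 0).
  - intros v _. destruct (Nat.leb_spec (nth 0 v 0) (nth 1 v 0)), (_ - _) eqn:E; simpl; auto; lia.
  - apply fn_ifz; [apply fn_sub; fn_proj| |]; apply fn_const.
Qed.

Lemma Cmp_andb (f g : X -> bool) : Cmp f -> Cmp g -> Cmp (fun x => f x && g x)%bool.
Proof. intros. apply Cmp_ext with (fun x => if f x then g x else false); [reflexivity|cmp]. Qed.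
Lemma Cmp_negb (f : X -> bool) : Cmp f -> Cmp (fun x => negb (f x)).
Proof. intros. apply Cmp_ext with (fun x => if f x then false else true); [reflexivity|cmp]. Qed.

Lemma Cmp_eqb (g h : X -> nat) : Cmp g -> Cmp h -> Cmp (fun x => g x =? h x).
Proof.
  intros. apply Cmp_ext with (fun x => (g x <=? h x) && (h x <=? g x))%bool.
  - intros x. destruct (Nat.eqb_spec (g x) (h x)), (Nat.leb_spec (g x) (h x)),
      (Nat.leb_spec (h x) (g x)); simpl; auto; lia.
  - auto using Cmp_andb, Cmp_leb.
Qed.

Lemma Cmp_seq (g h : X -> nat) : Cmp g -> Cmp h -> Cmp (fun x => seq (g x) (h x)).
Proof.
  intros. apply Cmp_ext with
    (fun x => nat_rect (fun _ => list nat) [] (fun m r => r ++ [g x + m]) (h x)).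
  - intros x. induction (h x); auto. rewrite seq_S. simpl. now rewrite IHn.
  - apply Cmp_nat_rect; cmp.
    apply Cmp_app; [cmp|]. apply Cmp_cons; [|cmp]. 
    apply (Cmp_nat2 Nat.add (fun p : X * nat * list nat => g (fst (fst p)))
      (fun p => snd (fst p))); [apply fn_add; fn_proj| |cmp].
    apply (Cmp_comp g (fun p : X * nat * list nat => fst (fst p))); cmp.
Qed.

Lemma Cmp_nth {B} `{Codable B} (i : X -> nat) (l : X -> list B) (d : X -> B) :
  Cmp i -> Cmp l -> Cmp d -> Cmp (fun x => nth (i x) (l x) (d x)).
Proof.
  intros.
  apply Cmp_ext with (fun x => snd (fold_left (fun (p : nat * B) b =>
     if i x =? fst p then (S (fst p), b) else (S (fst p), snd p)) (l x) (0, d x))).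
  - intros x.
    assert (E : forall l n e, snd (fold_left (fun (p : nat * B) b =>
      if i x =? fst p then (S (fst p), b) else (S (fst p), snd p)) l (n, e)) =
      if i x <? n then e else nth (i x - n) l e).
    { induction l0; intros n e; simpl.
      - destruct (i x <? n); auto. destruct (i x - n); auto.
      - destruct (Nat.eqb_spec (i x) n); rewrite IHl0;
        destruct (Nat.ltb_spec (i x) (S n)), (Nat.ltb_spec (i x) n); try lia; auto.
        + now replace (i x - n) with 0 by lia.
        + now replace (i x - n) with (S (i x - S n)) by lia. }
    rewrite E. simpl. now rewrite Nat.sub_0_r.
  - apply Cmp_snd. apply (Cmp_fold_left (fun x (p : nat * B) b =>
      if i x =? fst p then (S (fst p), b) else (S (fst p), snd p))); [|cmp..].
    assert (E : Cmp (fun p : X * (nat * B) * B => S (fst (snd (fst p))))).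
    { apply Cmp_nat1; [apply fn_S; fn_proj|cmp]. }
    apply Cmp_if; [|cmp..].
    apply (Cmp_comp (fun q : nat * nat => fst q =? snd q)
      (fun p : X * (nat * B) * B => (i (fst (fst p)), fst (snd (fst p))))).
    + apply (Cmp_nat2_bool Nat.eqb fst snd); [|cmp..].
      apply fn_ext with (fun v => ifz (nth 0 v 0 - nth 1 v 0 + (nth 1 v 0 - nth 0 v 0)) 1 0).
      * intros v _. destruct (Nat.eqb_spec (nth 0 v 0) (nth 1 v 0)), (_ + _) eqn:E'; simpl; auto; lia.
      * apply fn_ifz; [apply fn_add; apply fn_sub; fn_proj| |]; apply fn_const.
    + apply Cmp_pair; [|cmp]. apply (Cmp_comp i (fun p : X * (nat * B) * B => fst (fst p))); cmp.
Qed.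
End NatOps.
#[global] Hint Resolve Cmp_S Cmp_add Cmp_sub Cmp_mul Cmp_leb Cmp_andb Cmp_negb Cmp_eqb Cmp_seq Cmp_nth : cmp.

(** * Integers and rationals *)

Section Numbers.
Context {X : Type} `{Codable X}.

(** Sign tag and absolute value in the code of an integer. The code of zero has no second entry,
    hence the side condition of [mag_Z]. *)
Let tag z := pi2 (item 0 (pi2 z)).
Let mag z := pi2 (item 1 (pi2 z)).

Lemma fn_tag k g : fn k g -> fn k (fun v => tag (g v)).
Proof. intros. now apply fn_pi2, (fn_item 0), fn_pi2. Qed.
Lemma fn_mag k g : fn k g -> fn k (fun v => mag (g v)).
Proof. intros. now apply fn_pi2, (fn_item 1), fn_pi2. Qed.
Lemma tag_Z z : tag (enc z) = match z with Z0 => 0 | Zpos _ => 1 | Zneg _ => 2 end.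
Proof.
  unfold tag, enc, tocode, Codable_Z. destruct z; simpl code_Z;
  rewrite enc_CList, pi2_cpair; simpl encl; simpl item; simpl pred; now rewrite pi1_cpair, pi2_cpair.
Qed.
Lemma mag_Z z : z <> 0%Z -> mag (enc z) = Z.abs_nat z.
Proof.
  unfold mag, enc, tocode, Codable_Z. destruct z; intros Hz; [easy|..]; simpl code_Z;
  rewrite enc_CList, pi2_cpair; simpl encl; simpl item; simpl pred;
  now rewrite pi2_cpair; simpl pred; rewrite pi1_cpair, pi2_cpair.
Qed.

Lemma Cmp_Zto_nat (g : X -> Z) : Cmp g -> Cmp (fun x => Z.to_nat (g x)).
Proof.
  apply (Cmp_comp Z.to_nat).
  exists (fun z => cpair 0 (ifz (tag z) 0 (ifz (tag z - 1) (mag z) 0))). split.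
  - pose proof (fn_proj 1 0 ltac:(lia)).
    repeat first [apply fn_cpair|apply fn_ifz|apply fn_mag|apply fn_tag|apply fn_sub|apply fn_const|assumption].
  - intros z. rewrite tag_Z. destruct z; simpl; auto. now rewrite mag_Z.
Qed.
Lemma Cmp_Zto_nat_opp (g : X -> Z) : Cmp g -> Cmp (fun x => Z.to_nat (- g x)).
Proof.
  apply (Cmp_comp (fun z => Z.to_nat (- z))).
  exists (fun z => cpair 0 (ifz (2 - tag z) (mag z) 0)). split.
  - pose proof (fn_proj 1 0 ltac:(lia)).
    repeat first [apply fn_cpair|apply fn_ifz|apply fn_mag|apply fn_tag|apply fn_sub|apply fn_const|assumption].
  - intros z. rewrite tag_Z. destruct z; simpl; auto. now rewrite mag_Z.
Qed.

(** The operations on integers below are written as differences of naturals formed from positive and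
    negative parts, so codes are assembled from sign and magnitude only here. *)
Lemma Cmp_Zdiff (f g : X -> nat) : Cmp f -> Cmp g -> Cmp (fun x => Z.of_nat (f x) - Z.of_nat (g x))%Z.
Proof.
  intros [f' [Hf Ef]] [g' [Hg Eg]].
  set (mk t m := cpair 1 (S (cpair (cpair 0 t) (S (cpair (cpair 0 m) 0))))).
  exists (fun x => let p := pi2 (f' x) - pi2 (g' x) in let q := pi2 (g' x) - pi2 (f' x) in
     ifz p (ifz q (enc 0%Z) (mk 2 q)) (mk 1 p)). split.
  - unfold mk.
    repeat first [apply fn_cpair|apply fn_ifz|apply fn_S|apply fn_pi2|apply fn_sub|apply fn_const|assumption].
  - intros x. rewrite Ef, Eg. change (enc (f x)) with (cpair 0 (f x)). change (enc (g x)) with (cpair 0 (g x)).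
    rewrite !pi2_cpair. cbv zeta.
    assert (Hm : forall n, mk 1 (S n) = enc (Z.of_nat (S n)) /\ mk 2 (S n) = enc (- Z.of_nat (S n))%Z).
    { intros n. simpl Z.of_nat. simpl Z.opp. unfold enc, tocode, Codable_Z. simpl code_Z.
      now rewrite SuccNat2Pos.id_succ. }
    destruct (f x - g x) eqn:E1; simpl ifz; [destruct (g x - f x) eqn:E2; simpl ifz|].
    + replace (_ - _)%Z with 0%Z by lia. reflexivity.
    + rewrite (proj2 (Hm _)). f_equal. lia.
    + rewrite (proj1 (Hm _)). f_equal. lia.
Qed.

Lemma Cmp_Pto_nat (g : X -> positive) : Cmp g -> Cmp (fun x => Pos.to_nat (g x)).
Proof. intros [g' Hg]. now exists g'. Qed.
Lemma Cmp_Pof_nat (g : X -> nat) : Cmp g -> Cmp (fun x => Pos.of_nat (g x)).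
Proof.
  intros Hg. destruct (Cmp_nat1 (fun n => ifz n 1 n) g) as [g' [Hg' Eg']]; auto.
  - apply fn_ifz; [|apply fn_const|]; fn_proj.
  - exists g'. split; auto. intros a. rewrite Eg'. unfold enc, tocode, Codable_nat, Codable_positive.
    f_equal. f_equal. destruct (g a); auto. now rewrite Nat2Pos.id.
Qed.
End Numbers.
#[global] Hint Resolve Cmp_Zto_nat Cmp_Zto_nat_opp Cmp_Zdiff Cmp_Pto_nat Cmp_Pof_nat : cmp.

Section Numbers2.
Context {X : Type} `{Codable X}.

Lemma Cmp_Zpos (g : X -> positive) : Cmp g -> Cmp (fun x => Zpos (g x)).
Proof.
  intros. apply Cmp_ext with (fun x => Z.of_nat (Pos.to_nat (g x)) - Z.of_nat 0)%Z; [lia|cmp].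
Qed.
Lemma Cmp_Zadd (f g : X -> Z) : Cmp f -> Cmp g -> Cmp (fun x => f x + g x)%Z.
Proof.
  intros. apply Cmp_ext with (fun x => Z.of_nat (Z.to_nat (f x) + Z.to_nat (g x)) -
    Z.of_nat (Z.to_nat (- f x) + Z.to_nat (- g x)))%Z; [lia|cmp].
Qed.
Lemma Cmp_Zopp (f : X -> Z) : Cmp f -> Cmp (fun x => - f x)%Z.
Proof.
  intros. apply Cmp_ext with (fun x => Z.of_nat (Z.to_nat (- f x)) - Z.of_nat (Z.to_nat (f x)))%Z; [lia|cmp].
Qed.
Lemma Cmp_Zmul (f g : X -> Z) : Cmp f -> Cmp g -> Cmp (fun x => f x * g x)%Z.
Proof.
  intros. apply Cmp_ext with (fun x => 
    Z.of_nat (Z.to_nat (f x) * Z.to_nat (g x) + Z.to_nat (- f x) * Z.to_nat (- g x)) -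
    Z.of_nat (Z.to_nat (f x) * Z.to_nat (- g x) + Z.to_nat (- f x) * Z.to_nat (g x)))%Z; [|cmp].
  intros x. destruct (f x), (g x); simpl Z.opp; rewrite ?Nat2Z.inj_add, ?Nat2Z.inj_mul; simpl Z.to_nat; lia.
Qed.
Lemma Cmp_Zleb (f g : X -> Z) : Cmp f -> Cmp g -> Cmp (fun x => f x <=? g x)%Z.
Proof.
  intros. apply Cmp_ext with (fun x => 
    Z.to_nat (f x) + Z.to_nat (- g x) <=? Z.to_nat (g x) + Z.to_nat (- f x)); [|cmp].
  intros x. destruct (Z.leb_spec (f x) (g x)), (Nat.leb_spec (Z.to_nat (f x) + Z.to_nat (- g x)) (Z.to_nat (g x) + Z.to_nat (- f x))); auto; lia.
Qed.
Lemma Cmp_Pmul (f g : X -> positive) : Cmp f -> Cmp g -> Cmp (fun x => f x * g x)%positive.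
Proof.
  intros. apply Cmp_ext with (fun x => Pos.of_nat (Pos.to_nat (f x) * Pos.to_nat (g x))); [|cmp].
  intros x. now rewrite <- Pos2Nat.inj_mul, Pos2Nat.id.
Qed.
Lemma Cmp_Qnum (f : X -> Q) : Cmp f -> Cmp (fun x => Qnum (f x)).
Proof. apply (Cmp_comp Qnum). now apply Cmp_item with 0 (fun q => [code_Z (Qnum q); CNat (Pos.to_nat (Qden q))]). Qed.
Lemma Cmp_Qden (f : X -> Q) : Cmp f -> Cmp (fun x => Qden (f x)).
Proof. apply (Cmp_comp Qden). now apply Cmp_item with 1 (fun q => [code_Z (Qnum q); CNat (Pos.to_nat (Qden q))]). Qed.
Lemma Cmp_Qmake (f : X -> Z) (g : X -> positive) : Cmp f -> Cmp g -> Cmp (fun x => f x # g x).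
Proof.
  (* A rational has the same code as the pair of its numerator and denominator. *)
  intros Hf Hg. destruct (Cmp_pair _ _ Hf Hg) as [h [Hh Eh]]. exists h. split; auto.
Qed.
End Numbers2.
#[global] Hint Resolve Cmp_Zpos Cmp_Zadd Cmp_Zopp Cmp_Zmul Cmp_Zleb Cmp_Pmul Cmp_Qnum Cmp_Qden Cmp_Qmake : cmp.

(* [b / a], meaningful only for [0 < a]. *)
Definition qdivp (b a : Q) : Q :=
  (Qnum b * Zpos (Qden a)) # (Qden b * Pos.of_nat (Z.to_nat (Qnum a))).

Section Numbers3.
Context {X : Type} `{Codable X}.
Lemma Cmp_Qplus (f g : X -> Q) : Cmp f -> Cmp g -> Cmp (fun x => f x + g x)%Q.
Proof. intros. unfold Qplus. cmp. Qed.
Lemma Cmp_Qmult (f g : X -> Q) : Cmp f -> Cmp g -> Cmp (fun x => f x * g x)%Q.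
Proof. intros. unfold Qmult. cmp. Qed.
Lemma Cmp_Qopp (f : X -> Q) : Cmp f -> Cmp (fun x => - f x)%Q.
Proof. intros. unfold Qopp. cmp. Qed.
Lemma Cmp_Qle_bool (f g : X -> Q) : Cmp f -> Cmp g -> Cmp (fun x => Qle_bool (f x) (g x)).
Proof. intros. unfold Qle_bool. cmp. Qed.
Lemma Cmp_qdivp (f g : X -> Q) : Cmp f -> Cmp g -> Cmp (fun x => qdivp (f x) (g x)).
Proof. intros. unfold qdivp. cmp. Qed.
End Numbers3.
#[global] Hint Resolve Cmp_Qplus Cmp_Qmult Cmp_Qopp Cmp_Qle_bool Cmp_qdivp : cmp.
(** * Linear constraints and the decision procedures *)

(** A linear form as a list of (index, coefficient): index 0 is the constant term, index [S y] the
    variable [y], and repeated indices add up. As a constraint, a form is required to be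
    nonnegative. *)
Notation lin := (list (nat * Q)).

Definition var (y : nat) : lin := [(S y, 1%Q)].
Definition cst (q : Q) : lin := [(0, q)].
Definition scale (q : Q) (e : lin) : lin := map (fun t => (fst t, (q * snd t)%Q)) e.
Definition ge (e1 e2 : lin) : lin := e1 ++ scale (-1) e2.
Definition subst (s : nat -> lin) (F : list lin) : list lin :=
  map (flat_map (fun t => if fst t =? 0 then [t] else scale (snd t) (s (pred (fst t))))) F.
Definition coef (y : nat) (e : lin) : Q :=
  fold_right (fun t acc => if fst t =? S y then (snd t + acc)%Q else acc) 0%Q e.
Definition rm (y : nat) (e : lin) : lin := filter (fun t => negb (fst t =? S y)) e.
Definition qpos (q : Q) : bool := negb (Qle_bool q 0).

(** One Fourier-Motzkin step. A constraint bounding [y] below and one bounding it above are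
    cross-multiplied by their positive coefficients, which avoids division. *)
Definition elim (y : nat) (F : list lin) : list lin :=
  map (rm y) (filter (fun e => negb (qpos (coef y e)) && negb (qpos (- coef y e)))%bool F) ++
  flat_map (fun p => map (fun n => scale (- coef y n) (rm y p) ++ scale (coef y p) (rm y n))
     (filter (fun n => qpos (- coef y n)) F)) (filter (fun p => qpos (coef y p)) F).

(** Simultaneous substitution; a variable beyond the list becomes the empty form, that is 0, in
    agreement with [env3]. *)
Definition ren (l : list lin) (F : list lin) : list lin := subst (fun y => nth y l []) F.

Section LinCmp.
Context {X : Type} `{Codable X}.
Lemma Cmp_pred (g : X -> nat) : Cmp g -> Cmp (fun x => pred (g x)).
Proof. apply Cmp_nat1, fn_pred. fn_proj. Qed.
Lemma Cmp_var (y : X -> nat) : Cmp y -> Cmp (fun x => var (y x)).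
Proof. intros. unfold var. cmp. Qed.
Lemma Cmp_cst (q : X -> Q) : Cmp q -> Cmp (fun x => cst (q x)).
Proof. intros. unfold cst. cmp. Qed.
Lemma Cmp_qpos (q : X -> Q) : Cmp q -> Cmp (fun x => qpos (q x)).
Proof. intros. unfold qpos. cmp. Qed.
End LinCmp.
#[global] Hint Resolve Cmp_pred Cmp_var Cmp_cst Cmp_qpos : cmp.

(* A function of the context stays computable in the context extended with a bound variable. *)
#[global] Hint Extern 3 (Cmp (fun x => ?f (@?g x))) => 
  match goal with Hf : Cmp f |- _ => apply (Cmp_comp f g Hf) end : cmp.
#[global] Hint Extern 4 (Cmp (fun x => ?f (@?g x) (@?h x))) => 
  match goal with Hf : Cmp (fun p => f (fst p) (snd p)) |- _ =>
    apply (Cmp_comp (fun p => f (fst p) (snd p)) (fun x => (g x, h x)) Hf) end : cmp.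

Section LinCmp2.
Context {X : Type} `{Codable X}.
Lemma Cmp_scale (q : X -> Q) (e : X -> lin) : Cmp q -> Cmp e -> Cmp (fun x => scale (q x) (e x)).
Proof. intros. unfold scale. cmp. Qed.
Lemma Cmp_coef (y : X -> nat) (e : X -> lin) : Cmp y -> Cmp e -> Cmp (fun x => coef (y x) (e x)).
Proof. intros. unfold coef. cmp. Qed.
Lemma Cmp_rm (y : X -> nat) (e : X -> lin) : Cmp y -> Cmp e -> Cmp (fun x => rm (y x) (e x)).
Proof. intros. unfold rm. cmp. Qed.
End LinCmp2.
#[global] Hint Resolve Cmp_scale Cmp_coef Cmp_rm : cmp.

Section LinCmp3.
Context {X : Type} `{Codable X}.
Lemma Cmp_ge (d e : X -> lin) : Cmp d -> Cmp e -> Cmp (fun x => ge (d x) (e x)).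
Proof. intros. unfold ge. cmp. Qed.
Lemma Cmp_subst (s : X -> nat -> lin) (F : X -> list lin) :
  Cmp (fun p : X * nat => s (fst p) (snd p)) -> Cmp F -> Cmp (fun x => subst (s x) (F x)).
Proof. intros. unfold subst. cmp. Qed.
Lemma Cmp_elim (y : X -> nat) (F : X -> list lin) :
  Cmp y -> Cmp F -> Cmp (fun x => elim (y x) (F x)).
Proof. intros. unfold elim. cmp. Qed.
End LinCmp3.
#[global] Hint Resolve Cmp_ge Cmp_subst Cmp_elim : cmp.

Lemma Cmp_ren {X} `{Codable X} (l : X -> list lin) (F : X -> list lin) :
  Cmp l -> Cmp F -> Cmp (fun x => ren (l x) (F x)).
Proof. intros. unfold ren. cmp. Qed.
#[global] Hint Resolve Cmp_ren : cmp.

(** * Automata as encoded data *)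

Definition edge : Type := nat * nat * etp.
Definition esrc (e : edge) : nat := fst (fst e).
Definition edst (e : edge) : nat := snd (fst e).
Definition epath (e : edge) : etp := snd e.
Definition is_ge (a : atom) : bool := match a with AGe _ _ => true | ALe _ _ => false end.
Definition bound (a : atom) : Q := match a with AGe _ c => c | ALe _ c => c end.
(** Bundles the arguments of [enc_input], so that the procedures are functions of one encoded value
    and the two encodings agree by conversion. *)
Record input : Type := { aut : seta; init : nat; energy : Q; lower : Q }.

#[global] Instance Codable_atom : Codable atom := code_atom.
#[global] Instance Codable_state : Codable state := code_state.
#[global] Instance Codable_trans : Codable trans := code_trans.
#[global] Instance Codable_etp : Codable etp := code_etp.
#[global] Instance Codable_edge : Codable edge := fun e => CList [CNat (esrc e); CNat (edst e); code_etp (epath e)].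
#[global] Instance Codable_seta : Codable seta := code_seta.
#[global] Instance Codable_input : Codable input :=
  fun i => CList [code_seta (aut i); CNat (init i); code_Q (energy i); code_Q (lower i)].

Ltac proj i := apply Cmp_comp; eapply (Cmp_item _ i); reflexivity.

Section Projections.
Context {X : Type} `{Codable X}.
Lemma Cmp_atom_clock (f : X -> atom) : Cmp f -> Cmp (fun x => atom_clock (f x)).
Proof.
  apply Cmp_comp, (Cmp_item _ 1 (fun a =>
    [CNat (if is_ge a then 0 else 1); CNat (atom_clock a); code_Q (bound a)])); now intros [].
Qed.
Lemma Cmp_bound (f : X -> atom) : Cmp f -> Cmp (fun x => bound (f x)).
Proof.
  apply Cmp_comp, (Cmp_item _ 2 (fun a =>
    [CNat (if is_ge a then 0 else 1); CNat (atom_clock a); code_Q (bound a)])); now intros [].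
Qed.
Lemma Cmp_is_ge (f : X -> atom) : Cmp f -> Cmp (fun x => is_ge (f x)).
Proof.
  intros. assert (Ht : Cmp (fun a => if is_ge a then 0 else 1)).
  { apply (Cmp_item _ 0 (fun a =>
      [CNat (if is_ge a then 0 else 1); CNat (atom_clock a); code_Q (bound a)])); now intros []. }
  apply Cmp_ext with (fun x => (if is_ge (f x) then 0 else 1) =? 0).
  - intros x. now destruct (is_ge _).
  - apply Cmp_eqb; [|cmp]. now apply (Cmp_comp (fun a => if is_ge a then 0 else 1) f).
Qed.
Lemma Cmp_rate (f : X -> state) : Cmp f -> Cmp (fun x => rate (f x)).
Proof. proj 0. Qed.
Lemma Cmp_inv (f : X -> state) : Cmp f -> Cmp (fun x => inv (f x) : list atom).
Proof. proj 1. Qed.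
Lemma Cmp_guard (f : X -> trans) : Cmp f -> Cmp (fun x => guard (f x) : list atom).
Proof. proj 0. Qed.
Lemma Cmp_upd (f : X -> trans) : Cmp f -> Cmp (fun x => upd (f x)).
Proof. proj 1. Qed.
Lemma Cmp_reset (f : X -> trans) : Cmp f -> Cmp (fun x => reset (f x)).
Proof. proj 2. Qed.
Lemma Cmp_mids (f : X -> etp) : Cmp f -> Cmp (fun x => mids (f x)).
Proof. proj 0. Qed.
Lemma Cmp_trs (f : X -> etp) : Cmp f -> Cmp (fun x => trs (f x)).
Proof. proj 1. Qed.
Lemma Cmp_esrc (f : X -> edge) : Cmp f -> Cmp (fun x => esrc (f x)).
Proof. proj 0. Qed.
Lemma Cmp_edst (f : X -> edge) : Cmp f -> Cmp (fun x => edst (f x)).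
Proof. proj 1. Qed.
Lemma Cmp_epath (f : X -> edge) : Cmp f -> Cmp (fun x => epath (f x)).
Proof. proj 2. Qed.
Lemma Cmp_nclk (f : X -> seta) : Cmp f -> Cmp (fun x => nclk (f x)).
Proof. proj 0. Qed.
Lemma Cmp_mstates (f : X -> seta) : Cmp f -> Cmp (fun x => mstates (f x)).
Proof. proj 1. Qed.
Lemma Cmp_edges (f : X -> seta) : Cmp f -> Cmp (fun x => edges (f x) : list edge).
Proof. proj 2. Qed.
Lemma Cmp_aut (f : X -> input) : Cmp f -> Cmp (fun x => aut (f x)).
Proof. proj 0. Qed.
Lemma Cmp_init (f : X -> input) : Cmp f -> Cmp (fun x => init (f x)).
Proof. proj 1. Qed.
Lemma Cmp_energy (f : X -> input) : Cmp f -> Cmp (fun x => energy (f x)).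
Proof. proj 2. Qed.
Lemma Cmp_lower (f : X -> input) : Cmp f -> Cmp (fun x => lower (f x)).
Proof. proj 3. Qed.
End Projections.
#[global] Hint Resolve Cmp_atom_clock Cmp_bound Cmp_is_ge Cmp_rate Cmp_inv Cmp_guard Cmp_upd
  Cmp_reset Cmp_mids Cmp_trs Cmp_esrc Cmp_edst Cmp_epath Cmp_nclk Cmp_mstates Cmp_edges
  Cmp_aut Cmp_init Cmp_energy Cmp_lower : cmp.

(* Variables of a constraint on a path: 0 is the current energy, 1 the final energy, 2 the upper
   bound, 3 the delay, and 4 + x is clock x. *)
Definition atomC (D : lin) (a : atom) : lin :=
  if is_ge a then ge (var (4 + atom_clock a) ++ D) (cst (bound a))
  else ge (cst (bound a)) (var (4 + atom_clock a) ++ D).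

Definition delayedE (s : state) : lin := var 0 ++ scale (rate s) (var 3).
Definition nextE (s : state) (t : trans) : lin := delayedE s ++ cst (upd t).

(** Constraints on the rest of the path are pulled back to the values before the step. The empty
    form is 0: it serves for reset clocks and for the delay variable, which is zero in [envp]. *)
Definition step_subst (s : state) (t : trans) (y : nat) : lin :=
  if y =? 0 then nextE s t else if y <=? 2 then var y else if y =? 3 then [] else
  if existsb (fun z => y - 4 =? z) (reset t) then [] else var y ++ var 3.

Definition stepC (L : Q) (s : state) (t : trans) (F : list lin) : list lin :=
  elim 3 (var 3 :: map (atomC []) (inv s) ++ map (atomC (var 3)) (inv s) ++
    map (atomC (var 3)) (guard t) ++
    [ge (var 0) (cst L); ge (var 2) (var 0); ge (delayedE s) (cst L); ge (var 2) (delayedE s);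
     ge (nextE s t) (cst L); ge (var 2) (nextE s t)] ++ subst (step_subst s t) F).

Definition endC (k : nat) : list lin :=
  ge (var 1) (var 0) :: ge (var 0) (var 1) ::
  flat_map (fun x => [var (4 + x); scale (-1) (var (4 + x))]) (seq 0 k).

Definition pathC (k : nat) (L : Q) (st : list (state * trans)) : list lin :=
  fold_right (fun q F => stepC L (fst q) (snd q) F) (endC k) st.

Definition dflt_trans : trans := {| guard := []; upd := 0%Q; reset := [] |}.
Definition steps (A : seta) (e : edge) : list (state * trans) :=
  map (fun i => (nth i (nth (esrc e) (mstates A) dflt_state :: mids (epath e)) dflt_state,
                 nth i (trs (epath e)) dflt_trans))
      (seq 0 (length (trs (epath e)))).

(* From here on variable 0 is the initial energy, 1 the final energy and 2 the upper bound. *)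
Definition edgeC (A : seta) (L : Q) (e : edge) : list lin :=
  ren [var 0; var 1; var 2] (pathC (nclk A) L (steps A e)).
Definition idC : list lin := [ge (var 1) (var 0); ge (var 0) (var 1)].
Definition compC (F G : list lin) : list lin :=
  elim 3 (ren [var 0; var 3; var 2] F ++ ren [var 3; var 1; var 2] G).

Definition graph (A : seta) (L : Q) : list (nat * nat * list lin) :=
  map (fun e : edge => (esrc e, edst e, edgeC A L e)) (edges A).
Definition pathsC (G : list (nat * nat * list lin)) (m n : nat) : list (list lin * nat) :=
  nat_rect (fun _ => list (list lin * nat)) [(idC, m)]
    (fun _ P => flat_map (fun q => flat_map (fun g =>
       if fst (fst g) =? snd q then [(compC (fst q) (snd g), snd (fst g))] else []) G) P) n.
Definition pathsC_upto (G : list (nat * nat * list lin)) (N m : nat) : list (list lin * nat) :=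
  flat_map (fun n => pathsC G m n) (seq 0 (S N)).
Definition loopsC (G : list (nat * nat * list lin)) (N m : nat) : list (list lin) :=
  map fst (filter (fun q => snd q =? m) (flat_map (fun n => pathsC G m n) (seq 1 N))).

(** Quantifier-free form of [win]: variables 3 and 4 are the ends of the interval, 5 and 6 their
    successors. *)
Definition winC (F : list lin) : list lin :=
  elim 3 (elim 4 (elim 5 (elim 6 (
    [ge (var 0) (var 3); ge (var 4) (var 0); ge (var 5) (var 3); ge (var 4) (var 5);
     ge (var 6) (var 3); ge (var 4) (var 6)] ++
    ren [var 3; var 5; var 2] F ++ ren [var 4; var 6; var 2] F)))).

(* In the formulas handed to [candidates], variable 0 is the number to minimize: the upper bound in
   [boundC], the opposite of an energy gain in [boostC], and the constant -1 in [directC]. *)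
Definition boundC (w0 : Q) (F1 F2 : list lin) : list lin :=
  elim 1 (ren [cst w0; var 1; var 0] F1 ++ ren [var 1; []; var 0] (winC F2)).
Definition directC (w0 : Q) (F1 F2 : list lin) : list lin :=
  elim 1 (elim 2 ([ge (var 0) (cst (-1)); ge (cst (-1)) (var 0)] ++
    ren [cst w0; var 2; var 1] F1 ++ ren [var 2; []; var 1] (winC F2))).
Definition boostC (w0 : Q) (F1 F2 F3 F4 : list lin) : list lin :=
  elim 1 (elim 2 (elim 3 (elim 4 (elim 5 (
    [ge (var 0) (cst (-1)); ge (var 3 ++ var 0) (var 2)] ++
    ren [cst w0; var 2; var 1] F1 ++ ren [var 2; var 3; var 1] F2 ++
    ren [var 4; var 5; var 1] F3 ++ ren [var 5; []; var 1] (winC F4)))))).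

Definition bound_formulas (G : list (nat * nat * list lin)) (N m : nat) (w0 : Q) : list (list lin) :=
  flat_map (fun q => map (fun F2 => boundC w0 (fst q) F2) (loopsC G N (snd q))) (pathsC_upto G N m).
Definition direct_formulas (G : list (nat * nat * list lin)) (N m : nat) (w0 : Q) : list (list lin) :=
  flat_map (fun q => map (fun F2 => directC w0 (fst q) F2) (loopsC G N (snd q))) (pathsC_upto G N m).
Definition boost_formulas (G : list (nat * nat * list lin)) (N m : nat) (w0 : Q) : list (list lin) :=
  flat_map (fun q => flat_map (fun F2 => flat_map (fun r => map (fun F4 =>
     boostC w0 (fst q) F2 (fst r) F4) (loopsC G N (snd r)))
     (pathsC_upto G N (snd q))) (loopsC G N (snd q))) (pathsC_upto G N m).

Definition evalQ (q : Q) (e : lin) : Q :=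
  fold_right (fun t acc => (snd t * (if fst t =? 0 then 1 else if fst t =? 1 then q else 0) + acc)%Q) 0%Q e.
Definition slope (e : lin) : Q := (evalQ 1 e + - evalQ 0 e)%Q.
Definition valid (F : list lin) (q : Q) : bool := forallb (fun e => Qle_bool 0 (evalQ q e)) F.
(** On variable 0 alone, a constraint of positive slope is a lower bound at its zero. A zero that
    satisfies all of [F] dominates every other lower bound, so only the minimum of the solution set
    survives the filter. *)
Definition candidates (F : list lin) : list Q :=
  filter (fun q => valid F q)
    (flat_map (fun e => if qpos (slope e) then [qdivp (- evalQ 0 e) (slope e)] else []) F).

(** One test serves both families: a negative candidate means solvability for a direct formula,
    whose variable 0 is pinned to -1, and a strict gain for a boost formula. *)
Definition decide (i : input) : bool :=
  existsb (fun F => existsb (fun q => qpos (- q)) (candidates F))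
    (direct_formulas (graph (aut i) (lower i)) (length (mstates (aut i))) (init i) (energy i) ++
     boost_formulas (graph (aut i) (lower i)) (length (mstates (aut i))) (init i) (energy i)).

(** Starting from the first entry keeps the result inside a nonempty list. *)
Definition minQ (l : list Q) : Q :=
  fold_right (fun q acc => if Qle_bool acc q then acc else q) (nth 0 l 0%Q) l.
Definition least_bound (i : input) : Q :=
  minQ (flat_map candidates
    (bound_formulas (graph (aut i) (lower i)) (length (mstates (aut i))) (init i) (energy i))).

(** * Computability of the decision procedures *)

Section Programs.
Context {X : Type} `{Codable X}.
Lemma Cmp_atomC (D : X -> lin) (a : X -> atom) : Cmp D -> Cmp a -> Cmp (fun x => atomC (D x) (a x)).
Proof. intros. unfold atomC. cmp. Qed.
Lemma Cmp_delayedE (s : X -> state) : Cmp s -> Cmp (fun x => delayedE (s x)).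
Proof. intros. unfold delayedE. cmp. Qed.
Hint Resolve Cmp_delayedE : cmp.
Lemma Cmp_nextE (s : X -> state) (t : X -> trans) : Cmp s -> Cmp t -> Cmp (fun x => nextE (s x) (t x)).
Proof. intros. unfold nextE. cmp. Qed.
End Programs.
#[global] Hint Resolve Cmp_atomC Cmp_delayedE Cmp_nextE : cmp.

Section Programs2.
Context {X : Type} `{Codable X}.
Lemma Cmp_step_subst (s : X -> state) (t : X -> trans) (y : X -> nat) :
  Cmp s -> Cmp t -> Cmp y -> Cmp (fun x => step_subst (s x) (t x) (y x)).
Proof. intros. unfold step_subst. cmp. Qed.
Lemma Cmp_endC (k : X -> nat) : Cmp k -> Cmp (fun x => endC (k x)).
Proof. intros. unfold endC. cmp. Qed.
Lemma Cmp_compC (F G : X -> list lin) : Cmp F -> Cmp G -> Cmp (fun x => compC (F x) (G x)).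
Proof. intros. unfold compC. cmp. Qed.
Lemma Cmp_winC (F : X -> list lin) : Cmp F -> Cmp (fun x => winC (F x)).
Proof. intros. unfold winC. cmp. Qed.
Lemma Cmp_evalQ (q : X -> Q) (e : X -> lin) : Cmp q -> Cmp e -> Cmp (fun x => evalQ (q x) (e x)).
Proof. intros. unfold evalQ. cmp. Qed.
Lemma Cmp_minQ (l : X -> list Q) : Cmp l -> Cmp (fun x => minQ (l x)).
Proof. intros. unfold minQ. cmp. Qed.
End Programs2.
#[global] Hint Resolve Cmp_step_subst Cmp_endC Cmp_compC Cmp_winC Cmp_evalQ Cmp_minQ : cmp.

Section Programs3.
Context {X : Type} `{Codable X}.
Lemma Cmp_stepC (L : X -> Q) (s : X -> state) (t : X -> trans) (F : X -> list lin) :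
  Cmp L -> Cmp s -> Cmp t -> Cmp F -> Cmp (fun x => stepC (L x) (s x) (t x) (F x)).
Proof. intros. unfold stepC. cmp. Qed.
Lemma Cmp_steps (A : X -> seta) (e : X -> edge) : Cmp A -> Cmp e -> Cmp (fun x => steps (A x) (e x)).
Proof. intros. unfold steps. cmp. Qed.
Lemma Cmp_pathsC (G : X -> list (nat * nat * list lin)) (m n : X -> nat) :
  Cmp G -> Cmp m -> Cmp n -> Cmp (fun x => pathsC (G x) (m x) (n x)).
Proof. intros. unfold pathsC. cmp. Qed.
Lemma Cmp_boundC (w : X -> Q) (F1 F2 : X -> list lin) :
  Cmp w -> Cmp F1 -> Cmp F2 -> Cmp (fun x => boundC (w x) (F1 x) (F2 x)).
Proof. intros. unfold boundC. cmp. Qed.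
Lemma Cmp_directC (w : X -> Q) (F1 F2 : X -> list lin) :
  Cmp w -> Cmp F1 -> Cmp F2 -> Cmp (fun x => directC (w x) (F1 x) (F2 x)).
Proof. intros. unfold directC. cmp. Qed.
Lemma Cmp_boostC (w : X -> Q) (F1 F2 F3 F4 : X -> list lin) :
  Cmp w -> Cmp F1 -> Cmp F2 -> Cmp F3 -> Cmp F4 ->
  Cmp (fun x => boostC (w x) (F1 x) (F2 x) (F3 x) (F4 x)).
Proof. intros. unfold boostC. cmp. Qed.
Lemma Cmp_slope (e : X -> lin) : Cmp e -> Cmp (fun x => slope (e x)).
Proof. intros. unfold slope. cmp. Qed.
Lemma Cmp_valid (F : X -> list lin) (q : X -> Q) : Cmp F -> Cmp q -> Cmp (fun x => valid (F x) (q x)).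
Proof. intros. unfold valid. cmp. Qed.
End Programs3.
#[global] Hint Resolve Cmp_stepC Cmp_steps Cmp_pathsC Cmp_boundC Cmp_directC Cmp_boostC
  Cmp_slope Cmp_valid : cmp.

Section Programs4.
Context {X : Type} `{Codable X}.
Lemma Cmp_pathC (k : X -> nat) (L : X -> Q) (st : X -> list (state * trans)) :
  Cmp k -> Cmp L -> Cmp st -> Cmp (fun x => pathC (k x) (L x) (st x)).
Proof. intros. unfold pathC. cmp. Qed.
Lemma Cmp_pathsC_upto (G : X -> list (nat * nat * list lin)) (N m : X -> nat) :
  Cmp G -> Cmp N -> Cmp m -> Cmp (fun x => pathsC_upto (G x) (N x) (m x)).
Proof. intros. unfold pathsC_upto. cmp. Qed.
Lemma Cmp_loopsC (G : X -> list (nat * nat * list lin)) (N m : X -> nat) :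
  Cmp G -> Cmp N -> Cmp m -> Cmp (fun x => loopsC (G x) (N x) (m x)).
Proof. intros. unfold loopsC. cmp. Qed.
Lemma Cmp_candidates (F : X -> list lin) : Cmp F -> Cmp (fun x => candidates (F x)).
Proof. intros. unfold candidates. cmp. Qed.
End Programs4.
#[global] Hint Resolve Cmp_pathC Cmp_pathsC_upto Cmp_loopsC Cmp_candidates : cmp.

Section Programs5.
Context {X : Type} `{Codable X}.
Lemma Cmp_edgeC (A : X -> seta) (L : X -> Q) (e : X -> edge) :
  Cmp A -> Cmp L -> Cmp e -> Cmp (fun x => edgeC (A x) (L x) (e x)).
Proof. intros. unfold edgeC. cmp. Qed.
Lemma Cmp_bound_formulas (G : X -> list (nat * nat * list lin)) (N m : X -> nat) (w : X -> Q) :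
  Cmp G -> Cmp N -> Cmp m -> Cmp w -> Cmp (fun x => bound_formulas (G x) (N x) (m x) (w x)).
Proof. intros. unfold bound_formulas. cmp. Qed.
Lemma Cmp_direct_formulas (G : X -> list (nat * nat * list lin)) (N m : X -> nat) (w : X -> Q) :
  Cmp G -> Cmp N -> Cmp m -> Cmp w -> Cmp (fun x => direct_formulas (G x) (N x) (m x) (w x)).
Proof. intros. unfold direct_formulas. cmp. Qed.
Lemma Cmp_boost_formulas (G : X -> list (nat * nat * list lin)) (N m : X -> nat) (w : X -> Q) :
  Cmp G -> Cmp N -> Cmp m -> Cmp w -> Cmp (fun x => boost_formulas (G x) (N x) (m x) (w x)).
Proof. intros. unfold boost_formulas. cmp. Qed.
End Programs5.
#[global] Hint Resolve Cmp_edgeC Cmp_bound_formulas Cmp_direct_formulas Cmp_boost_formulas : cmp.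

Lemma Cmp_graph {X} `{Codable X} (A : X -> seta) (L : X -> Q) :
  Cmp A -> Cmp L -> Cmp (fun x => graph (A x) (L x)).
Proof. intros. unfold graph. cmp. Qed.
#[global] Hint Resolve Cmp_graph : cmp.

Lemma Cmp_decide : Cmp decide.
Proof. apply Cmp_ext with (fun i => decide i); [reflexivity|]. unfold decide. cmp. Qed.
Lemma Cmp_least_bound : Cmp least_bound.
Proof. apply Cmp_ext with (fun i => least_bound i); [reflexivity|]. unfold least_bound. cmp. Qed.
Local Open Scope R_scope.

(** * Semantics of linear constraints *)

Lemma Q2R_0 : Q2R 0 = 0.
Proof. unfold Q2R; simpl; lra. Qed.
Lemma Q2R_1 : Q2R 1 = 1.
Proof. unfold Q2R; simpl; lra. Qed.
Lemma Q2R_m1 : Q2R (-1) = -1.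
Proof. unfold Q2R; simpl; lra. Qed.

Definition val (r : nat -> R) (x : nat) : R := match x with O => 1 | S y => r y end.
Definition ev (r : nat -> R) (e : lin) : R :=
  fold_right (fun t acc => Q2R (snd t) * val r (fst t) + acc) 0 e.
Definition sat (r : nat -> R) (F : list lin) : Prop := forall e, In e F -> 0 <= ev r e.
Definition upd_env (r : nat -> R) (y : nat) (a : R) : nat -> R := fun z => if (z =? y)%nat then a else r z.

Lemma ev_app r e1 e2 : ev r (e1 ++ e2) = ev r e1 + ev r e2.
Proof. unfold ev. induction e1; simpl; [lra|]. rewrite IHe1. lra. Qed.
Lemma ev_scale r q e : ev r (scale q e) = Q2R q * ev r e.
Proof. unfold ev, scale. induction e; simpl; [lra|]. rewrite IHe, Q2R_mult. lra. Qed.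
Lemma ev_var r y : ev r (var y) = r y.
Proof. unfold ev. simpl. rewrite Q2R_1. lra. Qed.
Lemma ev_cst r q : ev r (cst q) = Q2R q.
Proof. unfold ev. simpl. lra. Qed.
Lemma ev_nil r : ev r [] = 0.
Proof. reflexivity. Qed.
Lemma ev_ge r e1 e2 : ev r (ge e1 e2) = ev r e1 - ev r e2.
Proof. unfold ge. rewrite ev_app, ev_scale, Q2R_m1. lra. Qed.
Lemma ev_ext r r' e : (forall y, r y = r' y) -> ev r e = ev r' e.
Proof.
  intros E. unfold ev. induction e as [|[[|y] q] e IH]; simpl in *; auto; rewrite IH, ?E; lra.
Qed.
Lemma ev_rm r y e : ev r e = Q2R (coef y e) * r y + ev r (rm y e).
Proof.
  unfold coef, rm. induction e as [|[x q] e IH]; simpl; [rewrite Q2R_0; lra|].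
  destruct (Nat.eqb_spec x (S y)); simpl in *; unfold ev in *; simpl; rewrite IH;
    [subst; simpl; rewrite Q2R_plus|]; lra.
Qed.
Lemma ev_rm_upd r y a e : ev (upd_env r y a) (rm y e) = ev r (rm y e).
Proof.
  unfold rm, ev. induction e as [|[x q] e IH]; simpl; auto.
  destruct (Nat.eqb_spec x (S y)); simpl; auto. f_equal; auto. f_equal.
  destruct x; simpl; auto. unfold upd_env. destruct (Nat.eqb_spec x y); congruence.
Qed.
Lemma ev_upd r y a e : ev (upd_env r y a) e = Q2R (coef y e) * a + ev r (rm y e).
Proof. rewrite (ev_rm _ y), ev_rm_upd. unfold upd_env. now rewrite Nat.eqb_refl. Qed.

Lemma sat_ext r r' F : (forall y, r y = r' y) -> sat r F -> sat r' F.
Proof. intros E H e He. rewrite <- (ev_ext r r' e E). auto. Qed.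
Lemma sat_app r F G : sat r (F ++ G) <-> sat r F /\ sat r G.
Proof.
  split.
  - intros H; split; intros e He; apply H, in_or_app; auto.
  - intros [H1 H2] e He. apply in_app_or in He as []; auto.
Qed.
Lemma sat_cons r e F : sat r (e :: F) <-> 0 <= ev r e /\ sat r F.
Proof.
  split.
  - intros H; split; [|intros d Hd]; apply H; simpl; auto.
  - intros [H1 H2] d [<-|Hd]; auto.
Qed.
Lemma sat_nil r : sat r [] <-> True.
Proof. split; auto. intros _ e []. Qed.

Lemma sat_subst r s F : sat r (subst s F) <-> sat (fun y => ev r (s y)) F.
Proof.
  unfold sat, subst.
  assert (E : forall e, ev r (flat_map (fun t => if (fst t =? 0)%nat then [t] else
      scale (snd t) (s (pred (fst t)))) e) = ev (fun y => ev r (s y)) e).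
  { induction e as [|[x q] e IH]; auto. simpl flat_map. rewrite ev_app, IH.
    destruct x; simpl; [|rewrite ev_scale]; unfold ev; simpl; lra. }
  split; intros H e He.
  - rewrite <- E. apply H. rewrite in_map_iff. eauto.
  - apply in_map_iff in He as [d [<- Hd]]. rewrite E. auto.
Qed.

Lemma qpos_spec q : qpos q = true <-> 0 < Q2R q.
Proof.
  unfold qpos. rewrite Bool.negb_true_iff. split; intros H.
  - rewrite <- Q2R_0. apply Qlt_Rlt. apply Qnot_le_lt. intros Hle. apply Qle_bool_iff in Hle. congruence.
  - destruct (Qle_bool q 0) eqn:E; auto. apply Qle_bool_iff, Qle_Rle in E. rewrite Q2R_0 in E. lra.
Qed.
Lemma qpos_opp_spec q : qpos (- q) = true <-> Q2R q < 0.
Proof. rewrite qpos_spec, Q2R_opp. lra. Qed.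

(** The one-dimensional core of Fourier-Motzkin. Either list may be empty, so the point starts below
    all upper bounds and is then raised to each lower bound. *)
Lemma interpolate (lo up : list R) :
  (forall l u, In l lo -> In u up -> l <= u) ->
  exists r, (forall l, In l lo -> l <= r) /\ (forall u, In u up -> r <= u).
Proof.
  induction lo as [|l lo IH]; intros H.
  - clear H. induction up as [|u up [r [_ Hr]]].
    + exists 0. split; intros ? [].
    + exists (Rmin u r). split; [intros ? []|]. intros x [<-|Hx]; [apply Rmin_l|].
      eapply Rle_trans; [apply Rmin_r|auto].
  - destruct IH as [r [H1 H2]]. { intros; apply H; simpl; auto. }
    exists (Rmax l r). split.
    + intros x [<-|Hx]; [apply Rmax_l|]. eapply Rle_trans; [|apply Rmax_r]; auto.
    + intros u Hu. apply Rmax_lub; auto. apply H; simpl; auto.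
Qed.

Lemma sat_elim r y F : sat r (elim y F) <-> exists a, sat (upd_env r y a) F.
Proof.
  unfold elim. rewrite sat_app. split.
  - intros [Hz Hc].
    (* Positive coefficients give the lower bounds of the eliminated variable, negative ones its
       upper bounds; the combined constraints say that each of the former is at most each of the
       latter. *)
    set (lo := map (fun p => - ev r (rm y p) / Q2R (coef y p)) (filter (fun p => qpos (coef y p)) F)).
    set (up := map (fun n => ev r (rm y n) / Q2R (- coef y n)) (filter (fun n => qpos (- coef y n)) F)).
    destruct (interpolate lo up) as [a [Ha Hb]].
    { intros l u Hl Hu. apply in_map_iff in Hl as [p [<- Hp]]. apply in_map_iff in Hu as [n [<- Hn]].
      assert (Hd : 0 <= ev r (scale (- coef y n) (rm y p) ++ scale (coef y p) (rm y n))).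
      { apply Hc. apply in_flat_map. exists p. split; auto. apply in_map_iff. eauto. }
      rewrite ev_app, !ev_scale in Hd.
      apply filter_In in Hp as [_ Hp]. apply filter_In in Hn as [_ Hn]. apply qpos_spec in Hp, Hn.
      set (A := Q2R (coef y p)) in *. set (B := Q2R (- coef y n)) in *.
      apply Rmult_le_reg_l with (A * B); [now apply Rmult_lt_0_compat|].
      replace (A * B * (- ev r (rm y p) / A)) with (- (B * ev r (rm y p))) by (field; lra).
      replace (A * B * (ev r (rm y n) / B)) with (A * ev r (rm y n)) by (field; lra). lra. }
    exists a. intros e He. rewrite ev_upd.
    destruct (qpos (coef y e)) eqn:Ep; [|destruct (qpos (- coef y e)) eqn:En].
    + specialize (Ha (- ev r (rm y e) / Q2R (coef y e))).
      assert (Hin : In e (filter (fun p => qpos (coef y p)) F)) by (apply filter_In; auto).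
      apply qpos_spec in Ep. specialize (Ha (in_map _ _ _ Hin)).
      apply Rmult_le_compat_l with (r := Q2R (coef y e)) in Ha; [|lra].
      replace (Q2R (coef y e) * (- ev r (rm y e) / Q2R (coef y e))) with (- ev r (rm y e)) in Ha by (field; lra).
      lra.
    + assert (Hin : In e (filter (fun p => qpos (- coef y p)) F)) by (apply filter_In; auto).
      apply qpos_spec in En. specialize (Hb _ (in_map (fun n => ev r (rm y n) / Q2R (- coef y n)) _ _ Hin)).
      simpl in Hb.
      apply Rmult_le_compat_l with (r := Q2R (- coef y e)) in Hb; [|lra].
      replace (Q2R (- coef y e) * (ev r (rm y e) / Q2R (- coef y e))) with (ev r (rm y e)) in Hb by (field; lra).
      rewrite Q2R_opp in Hb. lra.
    + assert (E0 : Q2R (coef y e) = 0).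
      { destruct (Rtotal_order (Q2R (coef y e)) 0) as [Hl|[|Hl]]; auto.
        - apply qpos_opp_spec in Hl. congruence.
        - apply qpos_spec in Hl. congruence. }
      rewrite E0. enough (0 <= ev r (rm y e)) by lra.
      apply Hz. apply in_map, filter_In. split; auto. now rewrite Ep, En.
  - intros [a Ha]. split; intros e He.
    + apply in_map_iff in He as [d [<- Hd]]. apply filter_In in Hd as [Hd Hs].
      apply andb_prop in Hs as [H1 H2]. specialize (Ha d Hd). rewrite ev_upd in Ha.
      assert (E0 : Q2R (coef y d) = 0).
      { destruct (Rtotal_order (Q2R (coef y d)) 0) as [Hl|[|Hl]]; auto.
        - apply qpos_opp_spec in Hl. rewrite Hl in H2. discriminate.
        - apply qpos_spec in Hl. rewrite Hl in H1. discriminate. }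
      rewrite E0 in Ha. lra.
    + apply in_flat_map in He as [p [Hp He]]. apply in_map_iff in He as [n [<- Hn]].
      apply filter_In in Hp as [Hp Sp]. apply filter_In in Hn as [Hn Sn].
      apply Ha in Hp, Hn. rewrite ev_upd in Hp, Hn. apply qpos_spec in Sp, Sn.
      rewrite Q2R_opp in Sn. rewrite ev_app, !ev_scale, Q2R_opp.
      apply Rmult_le_compat_l with (r := - Q2R (coef y n)) in Hp; [|lra].
      apply Rmult_le_compat_l with (r := Q2R (coef y p)) in Hn; [|lra]. lra.
Qed.

Definition env3 (a b c : R) : nat -> R :=
  fun y => match y with O => a | 1%nat => b | 2%nat => c | _ => 0 end.
Definition rel (F : list lin) (w w' U : R) : Prop := sat (env3 w w' U) F.

Lemma sat_ren r a b c F : sat r (ren [a; b; c] F) <-> rel F (ev r a) (ev r b) (ev r c).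
Proof.
  unfold ren, rel. rewrite sat_subst. split; apply sat_ext; intros [|[|[|[|y]]]]; reflexivity.
Qed.

Ltac sat := repeat first [rewrite sat_app | rewrite sat_cons | rewrite sat_nil | rewrite sat_ren |
  rewrite ev_ge | rewrite ev_app | rewrite ev_scale | rewrite ev_var | rewrite ev_cst | rewrite ev_nil];
  unfold upd_env; cbn [Nat.eqb env3].

Lemma rel_idC w w' U : rel idC w w' U <-> w' = w.
Proof. unfold rel, idC. sat. split; intros; [lra|]. intuition lra. Qed.

Lemma rel_compC F G w w' U : rel (compC F G) w w' U <-> exists v, rel F w v U /\ rel G v w' U.
Proof. unfold rel at 1, compC. rewrite sat_elim. split; intros [v H]; exists v; revert H; now sat. Qed.

(* The loop [F] can be iterated forever below [U] from [w]: the interval spanned by [a] and [b] is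
   stable, the successors of [a] and [b] being enough by convexity. *)
Definition win (F : list lin) (w U : R) : Prop :=
  exists a b a' b', a <= w <= b /\ a <= a' <= b /\ a <= b' <= b /\ rel F a a' U /\ rel F b b' U.

Lemma rel_winC F w x U : rel (winC F) w x U <-> win F w U.
Proof.
  unfold rel, winC. rewrite sat_elim. split.
  - intros [a H]. rewrite sat_elim in H. destruct H as [b H]. rewrite sat_elim in H. destruct H as [a' H].
    rewrite sat_elim in H. destruct H as [b' H]. exists a, b, a', b'. revert H. sat. intuition lra.
  - intros (a & b & a' & b' & H). exists a. rewrite sat_elim. exists b. rewrite sat_elim. exists a'.
    rewrite sat_elim. exists b'. sat. intuition lra.
Qed.

(** * Minimization over one variable *)

Definition env1 (t : R) : nat -> R := fun y => match y with O => t | _ => 0 end.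

Lemma sat_boundC w0 F1 F2 U : sat (env1 U) (boundC w0 F1 F2) <->
  exists w, rel F1 (Q2R w0) w U /\ win F2 w U.
Proof.
  unfold boundC. rewrite sat_elim. split; intros [w H]; exists w; revert H; sat; now rewrite rel_winC.
Qed.

Lemma sat_directC w0 F1 F2 t : sat (env1 t) (directC w0 F1 F2) <->
  t = -1 /\ exists U w, rel F1 (Q2R w0) w U /\ win F2 w U.
Proof.
  unfold directC. rewrite sat_elim. split.
  - intros [U H]. rewrite sat_elim in H. destruct H as [w H]. revert H. sat.
    rewrite rel_winC, Q2R_m1. cbn [env1]. intros. split; [lra|]. exists U, w. tauto.
  - intros [-> (U & w & H)]. exists U. rewrite sat_elim. exists w. sat.
    rewrite rel_winC, Q2R_m1. cbn [env1]. intuition lra.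
Qed.

(** Nothing relates [w2] to [x]: a strict gain from [w1] to [w2] can be repeated until [x] is
    exceeded. The solutions [t] are at least [w1 - w2], so a negative one witnesses the gain, and
    the bound -1 keeps the minimum finite. *)
Lemma sat_boostC w0 F1 F2 F3 F4 t : sat (env1 t) (boostC w0 F1 F2 F3 F4) <->
  -1 <= t /\ exists U w1 w2 x y, w1 <= w2 + t /\ rel F1 (Q2R w0) w1 U /\ rel F2 w1 w2 U /\
    rel F3 x y U /\ win F4 y U.
Proof.
  unfold boostC. rewrite sat_elim. split.
  - intros [U H]. rewrite sat_elim in H. destruct H as [w1 H]. rewrite sat_elim in H. destruct H as [w2 H].
    rewrite sat_elim in H. destruct H as [x H]. rewrite sat_elim in H. destruct H as [y H]. revert H. sat.
    rewrite rel_winC, Q2R_m1. cbn [env1]. intros. split; [lra|]. exists U, w1, w2, x, y. intuition lra.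
  - intros [Ht (U & w1 & w2 & x & y & H)]. exists U. rewrite sat_elim. exists w1.
    rewrite sat_elim. exists w2. rewrite sat_elim. exists x. rewrite sat_elim. exists y. sat.
    rewrite rel_winC, Q2R_m1. cbn [env1]. intuition lra.
Qed.

Lemma ev_env1 q e : ev (env1 (Q2R q)) e = Q2R (evalQ q e).
Proof.
  unfold ev, evalQ. induction e as [|[x c] e IH]; simpl; [now rewrite Q2R_0|].
  rewrite IH, Q2R_plus, Q2R_mult. f_equal. f_equal. destruct x as [|[|x]]; simpl; auto using Q2R_0, Q2R_1.
  all: now rewrite ?Q2R_0, ?Q2R_1.
Qed.

Lemma ev_env1_affine t e : ev (env1 t) e = Q2R (slope e) * t + Q2R (evalQ 0 e).
Proof.
  unfold slope. rewrite Q2R_plus, Q2R_opp, <- !ev_env1, Q2R_0, Q2R_1.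
  unfold ev. induction e as [|[x c] e IH]; simpl; [lra|]. rewrite IH.
  destruct x as [|[|x]]; simpl; lra.
Qed.

Lemma valid_spec F q : valid F q = true <-> sat (env1 (Q2R q)) F.
Proof.
  unfold valid, sat. rewrite forallb_forall. split; intros H e He; specialize (H e He).
  - rewrite ev_env1. apply Qle_bool_iff, Qle_Rle in H. now rewrite Q2R_0 in H.
  - rewrite ev_env1, <- Q2R_0 in H. now apply Qle_bool_iff, Rle_Qle.
Qed.

Lemma Q2R_qdivp b a : 0 < Q2R a -> Q2R (qdivp b a) = Q2R b / Q2R a.
Proof.
  destruct b as [bn bd], a as [an ad]. unfold qdivp, Q2R. simpl. intros Ha.
  assert (0 < IZR an).
  { apply Rmult_lt_reg_r with (/ IZR (Zpos ad)); [|lra]. apply Rinv_0_lt_compat, (IZR_lt 0). lia. }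
  apply lt_IZR in H. destruct an; try lia. simpl Z.to_nat. rewrite Pos2Nat.id, Pos2Z.inj_mul, !mult_IZR.
  field. repeat split; apply not_0_IZR; lia.
Qed.

Lemma candidates_sound F q : In q (candidates F) -> sat (env1 (Q2R q)) F.
Proof. unfold candidates. rewrite filter_In, valid_spec. tauto. Qed.

Lemma max_lower_bound F t : (exists e, In e F /\ 0 < Q2R (slope e)) -> sat (env1 t) F ->
  exists e, In e F /\ 0 < Q2R (slope e) /\ - Q2R (evalQ 0 e) / Q2R (slope e) <= t /\
   forall d, In d F -> 0 < Q2R (slope d) ->
     - Q2R (evalQ 0 d) / Q2R (slope d) <= - Q2R (evalQ 0 e) / Q2R (slope e).
Proof.
  induction F as [|e F IH]; intros Hex Hs. { destruct Hex as [? [[] _]]. }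
  apply sat_cons in Hs as [He Hs]. rewrite ev_env1_affine in He.
  assert (Hb : 0 < Q2R (slope e) -> - Q2R (evalQ 0 e) / Q2R (slope e) <= t).
  { intros Hp. apply Rmult_le_reg_l with (Q2R (slope e)); auto.
    replace (Q2R (slope e) * (- Q2R (evalQ 0 e) / Q2R (slope e))) with (- Q2R (evalQ 0 e)) by (field; lra). lra. }
  destruct (classic (exists e, In e F /\ 0 < Q2R (slope e))) as [H|H].
  - destruct (IH H Hs) as (d & Hd & Pd & Bd & Md).
    destruct (Rlt_dec 0 (Q2R (slope e))) as [Pe|Pe].
    + destruct (Rle_dec (- Q2R (evalQ 0 e) / Q2R (slope e)) (- Q2R (evalQ 0 d) / Q2R (slope d))).
      * exists d. repeat split; simpl; auto. intros x [<-|Hx]; auto.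
      * exists e. repeat split; simpl; auto. intros x [<-|Hx] Px; [lra|]. specialize (Md x Hx Px). lra.
    + exists d. repeat split; simpl; auto. intros x [<-|Hx] Px; auto. lra.
  - destruct Hex as [x [[<-|Hx] Px]]; [|exfalso; eauto].
    exists e. repeat split; simpl; auto. intros d [<-|Hd] Pd; [lra|]. exfalso; eauto.
Qed.

(** The greatest zero among constraints of positive slope satisfies these by maximality, and the
    others because it lies to the left of the solution [t]. Without any positive slope the solutions
    would extend below [lb]. *)
Lemma candidates_complete F lb t : (forall s, sat (env1 s) F -> lb <= s) -> sat (env1 t) F ->
  exists q, In q (candidates F) /\ Q2R q <= t.
Proof.
  intros Hlb Ht.
  destruct (classic (exists e, In e F /\ 0 < Q2R (slope e))) as [H|H].
  - destruct (max_lower_bound F t H Ht) as (e & He & Pe & Be & Me).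
    exists (qdivp (- evalQ 0 e) (slope e)).
    assert (E : Q2R (qdivp (- evalQ 0 e) (slope e)) = - Q2R (evalQ 0 e) / Q2R (slope e)).
    { rewrite Q2R_qdivp, Q2R_opp; auto. }
    split; [|now rewrite E].
    unfold candidates. apply filter_In. split.
    + apply in_flat_map. exists e. split; auto. apply qpos_spec in Pe. rewrite Pe. simpl; auto.
    + apply valid_spec. intros d Hd. rewrite E, ev_env1_affine. specialize (Ht d Hd).
      rewrite ev_env1_affine in Ht.
      set (m := - Q2R (evalQ 0 e) / Q2R (slope e)) in *.
      destruct (Rlt_dec 0 (Q2R (slope d))) as [Pd|Pd].
      * specialize (Me d Hd Pd). apply Rmult_le_compat_l with (r := Q2R (slope d)) in Me; [|lra].
        replace (Q2R (slope d) * (- Q2R (evalQ 0 d) / Q2R (slope d))) with (- Q2R (evalQ 0 d)) in Me by (field; lra).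
        lra.
      * assert (Q2R (slope d) * t <= Q2R (slope d) * m); [|lra].
        apply Rmult_le_compat_neg_l; lra.
  - exfalso. assert (Hs : sat (env1 (Rmin t (lb - 1))) F).
    { intros d Hd. specialize (Ht d Hd). rewrite ev_env1_affine in *.
      assert (Q2R (slope d) <= 0) by (apply Rnot_lt_le; intros ?; eauto).
      assert (Q2R (slope d) * t <= Q2R (slope d) * Rmin t (lb - 1)); [|lra].
      apply Rmult_le_compat_neg_l; [lra|apply Rmin_l]. }
    apply Hlb in Hs. pose proof (Rmin_r t (lb - 1)). lra.
Qed.

Lemma minQ_spec l q : In q l -> In (minQ l) l /\ Q2R (minQ l) <= Q2R q.
Proof.
  unfold minQ. intros Hq.
  assert (H : forall l0 d, (fold_right (fun q acc => if Qle_bool acc q then acc else q) d l0 = d \/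
     In (fold_right (fun q acc => if Qle_bool acc q then acc else q) d l0) l0) /\
     forall q, In q l0 -> Q2R (fold_right (fun q acc => if Qle_bool acc q then acc else q) d l0) <= Q2R q).
  { clear. intros l d. induction l as [|a l [IH1 IH2]]; simpl; [tauto|].
    set (m := fold_right _ _ _) in *. destruct (Qle_bool m a) eqn:E.
    - apply Qle_bool_iff, Qle_Rle in E. split; [tauto|]. intros q [<-|Hq]; auto.
    - assert (Q2R a <= Q2R m).
      { apply Rnot_lt_le. intros Hlt. apply Rlt_Qlt, Qlt_le_weak, Qle_bool_iff in Hlt. congruence. }
      split; auto. intros q [<-|Hq]; [lra|]. specialize (IH2 q Hq). lra. }
  destruct (H l (nth 0 l 0%Q)) as [[E|E] Hm]; split; auto.
  rewrite E. destruct l; [destruct Hq|simpl; auto].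
Qed.

(** * Convexity, closedness and stable intervals *)

Lemma sat_convex r r' F s : 0 <= s <= 1 -> sat r F -> sat r' F ->
  sat (fun y => s * r y + (1 - s) * r' y) F.
Proof.
  intros Hs H1 H2 e He. specialize (H1 e He). specialize (H2 e He).
  assert (E : forall e, ev (fun y => s * r y + (1 - s) * r' y) e = s * ev r e + (1 - s) * ev r' e).
  { clear. unfold ev. induction e as [|[[|y] q] e IH]; simpl in *; [lra| |]; rewrite IH; lra. }
  rewrite E. apply Rplus_le_le_0_compat; apply Rmult_le_pos; lra.
Qed.

Lemma rel_convex F U s a a' b b' : 0 <= s <= 1 -> rel F a a' U -> rel F b b' U ->
  rel F (s * a + (1 - s) * b) (s * a' + (1 - s) * b') U.
Proof.
  intros Hs H1 H2. eapply sat_ext; [|exact (sat_convex _ _ _ s Hs H1 H2)].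
  intros [|[|[|y]]]; simpl; ring.
Qed.

(** Writing [w] as a convex combination of [a] and [b], the same combination of [a'] and [b'] is a
    successor by convexity and stays in the interval. The degenerate interval has no such
    coordinates and is treated apart. *)
Lemma stable_interval F U a b a' b' w : a <= a' <= b -> a <= b' <= b ->
  rel F a a' U -> rel F b b' U -> a <= w <= b -> exists w', a <= w' <= b /\ rel F w w' U.
Proof.
  intros Ha Hb Ra Rb Hw. destruct (Req_dec a b) as [E|E].
  - subst b. replace w with a by lra. exists a'. auto.
  - set (s := (b - w) / (b - a)).
    assert (Hs : 0 <= s <= 1).
    { split.
      - apply Rmult_le_pos; [lra|]. apply Rlt_le, Rinv_0_lt_compat. lra.
      - apply Rmult_le_reg_r with (b - a); [lra|]. unfold s.
        replace ((b - w) / (b - a) * (b - a)) with (b - w) by (field; lra). lra. }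
    exists (s * a' + (1 - s) * b'). split.
    + assert (s * a <= s * a' <= s * b) by (split; apply Rmult_le_compat_l; lra).
      assert ((1 - s) * a <= (1 - s) * b' <= (1 - s) * b) by (split; apply Rmult_le_compat_l; lra). lra.
    + replace w with (s * a + (1 - s) * b) by (unfold s; field; lra). now apply rel_convex.
Qed.

(* Eliminating the successor leaves non-strict linear constraints on [w], which pass to the limit [a]. *)
Lemma rel_inf F U lo hi a (u : R -> Prop) :
  (forall w, u w -> exists w', lo <= w' <= hi /\ rel F w w' U) ->
  (forall eps, 0 < eps -> exists w, u w /\ Rabs (w - a) < eps) ->
  exists a', lo <= a' <= hi /\ rel F a a' U.
Proof.
  intros Hu Ha.
  (* [lo], [hi] and [U] are real, so they enter as variables rather than rational constants;
     variable 4 is the successor. *)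
  set (r := fun w : R => fun y : nat => match y with O => w | 1%nat => U | 2%nat => lo | 3%nat => hi | _ => 0 end).
  set (G := elim 4 ([ge (var 4) (var 2); ge (var 3) (var 4)] ++ ren [var 0; var 4; var 1] F)).
  assert (HG : forall w, sat (r w) G <-> exists w', lo <= w' <= hi /\ rel F w w' U).
  { intros w. unfold G. rewrite sat_elim. split; intros [w' H]; exists w'; revert H; sat; cbn [r]; intuition lra. }
  apply HG. intros e He.
  assert (E : forall w, ev (r w) e = Q2R (coef 0 e) * w + ev (r a) (rm 0 e)).
  { intros w. rewrite <- ev_upd. apply ev_ext. intros [|y]; reflexivity. }
  apply Rnot_lt_le. intros Hlt. rewrite E in Hlt. set (c := Q2R (coef 0 e)) in *.
  set (k := ev (r a) (rm 0 e)) in *.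
  (* A point this close to [a] still violates the constraint violated at [a]; the added 1 keeps the
     denominator nonzero when [c = 0]. *)
  destruct (Ha ((- (c * a + k)) / (Rabs c + 1))) as [w [Hw Hd]].
  { apply Rmult_lt_0_compat; [lra|]. apply Rinv_0_lt_compat. pose proof (Rabs_pos c). lra. }
  apply Hu, HG in Hw. specialize (Hw e He). rewrite E in Hw.
  pose proof (Rabs_pos c).
  assert (Rabs (c * (w - a)) < - (c * a + k)).
  { rewrite Rabs_mult. apply Rle_lt_trans with ((Rabs c + 1) * Rabs (w - a)).
    - apply Rmult_le_compat_r; [apply Rabs_pos|lra].
    - apply Rmult_lt_compat_l with (r := Rabs c + 1) in Hd; [|lra].
      replace ((Rabs c + 1) * (- (c * a + k) / (Rabs c + 1))) with (- (c * a + k)) in Hd by (field; lra). lra. }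
  pose proof (Rle_abs (c * (w - a))). lra.
Qed.

Lemma win_of_sequence F U L (u : nat -> R) : (forall n, L <= u n <= U) ->
  (forall n, rel F (u n) (u (S n)) U) -> win F (u O) U.
Proof.
  intros Hb Hr.
  destruct (completeness (fun x => exists n, x = u n)) as [b [Hb1 Hb2]].
  { exists U. intros x [n ->]. apply Hb. } { exists (u O). eauto. }
  (* [completeness] yields suprema only, so the infimum of the sequence is [- a]. *)
  destruct (completeness (fun x => exists n, x = - u n)) as [a [Ha1 Ha2]].
  { exists (- L). intros x [n ->]. specialize (Hb n). lra. } { exists (- u O). eauto. }
  assert (Hin : forall n, - a <= u n <= b).
  { intros n. split; [specialize (Ha1 (- u n))|specialize (Hb1 (u n))]; eauto.
    assert (- u n <= a) by eauto. lra. }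
  assert (Hu : forall w, (exists n, w = u n) -> exists w', - a <= w' <= b /\ rel F w w' U).
  { intros w [n ->]. exists (u (S n)). auto. }
  destruct (rel_inf F U (- a) b (- a) _ Hu) as [a' [Ra1 Ra2]].
  { intros eps He. apply NNPP. intros Hn. assert (a <= a - eps); [|lra].
    apply Ha2. intros x [n ->]. apply Rnot_lt_le. intros Hlt. apply Hn. exists (u n). split; [eauto|].
    specialize (Hin n). rewrite Rabs_right; lra. }
  destruct (rel_inf F U (- a) b b _ Hu) as [b' [Rb1 Rb2]].
  { intros eps He. apply NNPP. intros Hn. assert (b <= b - eps); [|lra].
    apply Hb2. intros x [n ->]. apply Rnot_lt_le. intros Hlt. apply Hn. exists (u n). split; [eauto|].
    specialize (Hin n). rewrite Rabs_left1; lra. }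
  exists (- a), b, a', b'. auto.
Qed.
(** * Semantics of paths *)

Definition envp (v : valuation) (w w' U : R) : nat -> R :=
  fun y => match y with
  | O => w | 1%nat => w' | 2%nat => U | 3%nat => 0 | S (S (S (S x))) => v x end.

Lemma ev_atomC r D a : 0 <= ev r (atomC D a) <-> atom_holds (fun x => r (4 + x)%nat + ev r D) a.
Proof.
  unfold atomC. destruct a; simpl is_ge; cbv iota; simpl bound; rewrite ev_ge, ev_app, ev_var, ev_cst;
  simpl; lra.
Qed.

Lemma sat_atomC r D g : sat r (map (atomC D) g) <-> constr_holds (fun x => r (4 + x)%nat + ev r D) g.
Proof.
  unfold sat, constr_holds. split; intros H a Ha.
  - apply ev_atomC, H. now apply in_map.
  - apply in_map_iff in Ha as [b [<- Hb]]. apply ev_atomC. auto.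
Qed.

Lemma constr_holds_ext v v' g : (forall x, v x = v' x) -> constr_holds v g -> constr_holds v' g.
Proof. intros Ev H a Ha. specialize (H a Ha). destruct a; simpl in *; now rewrite <- Ev. Qed.

Lemma affine_between c l u x y t d : 0 <= t <= d -> l <= x <= u -> l <= x + d * c <= u -> y = x + t * c ->
  l <= y <= u.
Proof.
  intros Ht Hx Hd ->. destruct (Rle_dec 0 c).
  - assert (0 <= t * c <= d * c); [|lra].
    split; [apply Rmult_le_pos|apply Rmult_le_compat_r]; lra.
  - assert (d * c <= t * c <= 0); [|lra]. rewrite !(Rmult_comm _ c).
    split; [apply Rmult_le_compat_neg_l; lra|].
    replace 0 with (c * 0) by ring. apply Rmult_le_compat_neg_l; lra.
Qed.

(* Invariants and energy bounds are convex, so they hold during a delay as soon as they hold at its ends. *)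
Lemma sat_stepC L s t F v w w' U :
  sat (envp v w w' U) (stepC L s t F) <->
  exists d, 0 <= d /\
    (forall t0, 0 <= t0 <= d ->
       constr_holds (delay v t0) (inv s) /\ Q2R L <= w + t0 * Q2R (rate s) <= U) /\
    constr_holds (delay v d) (guard t) /\
    Q2R L <= w + d * Q2R (rate s) + Q2R (upd t) <= U /\
    sat (envp (reset_val (reset t) (delay v d)) (w + d * Q2R (rate s) + Q2R (upd t)) w' U) F.
Proof.
  unfold stepC. rewrite sat_elim.
  assert (H : forall d, let r := upd_env (envp v w w' U) 3 d in
    sat r (var 3 :: map (atomC []) (inv s) ++ map (atomC (var 3)) (inv s) ++
      map (atomC (var 3)) (guard t) ++
      [ge (var 0) (cst L); ge (var 2) (var 0); ge (delayedE s) (cst L); ge (var 2) (delayedE s);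
       ge (nextE s t) (cst L); ge (var 2) (nextE s t)] ++ subst (step_subst s t) F) <->
    0 <= d /\ constr_holds (delay v 0) (inv s) /\ constr_holds (delay v d) (inv s) /\
    constr_holds (delay v d) (guard t) /\ Q2R L <= w <= U /\ Q2R L <= w + d * Q2R (rate s) <= U /\
    Q2R L <= w + d * Q2R (rate s) + Q2R (upd t) <= U /\
    sat (envp (reset_val (reset t) (delay v d)) (w + d * Q2R (rate s) + Q2R (upd t)) w' U) F).
  { intros d r.
    assert (Ed : forall D g, constr_holds (fun x => r (4 + x)%nat + ev r D) g <-> constr_holds (delay v (ev r D)) g).
    { intros. split; apply constr_holds_ext; reflexivity. }
    assert (E1 : ev r (delayedE s) = w + d * Q2R (rate s)).
    { unfold delayedE. rewrite ev_app, ev_scale, !ev_var. unfold r, upd_env. simpl. lra. }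
    assert (E2 : ev r (nextE s t) = w + d * Q2R (rate s) + Q2R (upd t)).
    { unfold nextE. rewrite ev_app, ev_cst. lra. }
    assert (E3 : sat r (subst (step_subst s t) F) <->
      sat (envp (reset_val (reset t) (delay v d)) (w + d * Q2R (rate s) + Q2R (upd t)) w' U) F).
    { rewrite sat_subst.
      assert (Ey : forall y, ev r (step_subst s t y) =
        envp (reset_val (reset t) (delay v d)) (w + d * Q2R (rate s) + Q2R (upd t)) w' U y).
      { intros [|[|[|[|x]]]]; unfold step_subst; cbn [Nat.eqb Nat.leb].
        - exact E2.
        - now rewrite ev_var.
        - now rewrite ev_var.
        - reflexivity.
        - replace (S (S (S (S x))) - 4)%nat with x by lia. cbn [envp]. unfold reset_val.
          destruct (existsb _ _) eqn:Ex.
          + apply existsb_exists in Ex as [z [Hz Hx]]. apply Nat.eqb_eq in Hx. subst z.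
            destruct (in_dec _ _ _); [reflexivity|contradiction].
          + destruct (in_dec _ _ _) as [Hi|Hi].
            * assert (existsb (fun z => (x =? z)%nat) (reset t) = true); [|congruence].
              apply existsb_exists. exists x. now rewrite Nat.eqb_refl.
            * rewrite ev_app, !ev_var. reflexivity. }
      split; apply sat_ext; auto. }
    rewrite sat_cons, !sat_app, !sat_atomC, !Ed, E3, !sat_cons, sat_nil, !ev_ge, E1, E2, !ev_var, !ev_cst, ev_nil.
    unfold r, upd_env. cbn [Nat.eqb envp]. intuition lra. }
  split.
  - intros [d Hd]. apply H in Hd as (Hd & H0 & H1 & H2 & H3 & H4 & H5 & H6). exists d.
    repeat (split; try assumption); try (destruct H5; assumption).
    + intros a Ha. specialize (H0 a Ha). specialize (H1 a Ha). unfold delay in *.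
      destruct a as [x c|x c]; simpl in *; lra.
    + apply (affine_between (Q2R (rate s)) (Q2R L) U w _ t0 d); auto.
    + apply (affine_between (Q2R (rate s)) (Q2R L) U w _ t0 d); auto.
  - intros (d & Hd & Hi & Hg & Hw & HF). exists d. apply H.
    assert (A0 : 0 <= 0 <= d) by lra. assert (A1 : 0 <= d <= d) by lra.
    destruct (Hi 0 A0) as [I0 W0]. destruct (Hi d A1) as [I1 W1].
    repeat (split; try assumption); try lra.
Qed.

Lemma sat_endC k v w w' U : sat (envp v w w' U) (endC k) <->
  w' = w /\ (forall x, (x < k)%nat -> v x = 0).
Proof.
  unfold endC. rewrite !sat_cons, !ev_ge, !ev_var. cbn [envp].
  assert (Hk : sat (envp v w w' U) (flat_map (fun x => [var (4 + x); scale (-1) (var (4 + x))]) (seq 0 k)) <->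
    (forall x, (x < k)%nat -> v x = 0)).
  { split.
    - intros H x Hx.
      assert (H1 := H (var (4 + x))). assert (H2 := H (scale (-1) (var (4 + x)))).
      rewrite ev_scale, ev_var, Q2R_m1 in *. simpl in H1, H2.
      rewrite !in_flat_map in H1, H2.
      assert (In x (seq 0 k)) by (apply in_seq; lia).
      assert (0 <= v x) by (apply H1; exists x; simpl; auto).
      assert (0 <= -1 * v x) by (apply H2; exists x; simpl; auto). lra.
    - intros H e He. apply in_flat_map in He as [x [Hx He]]. apply in_seq in Hx.
      specialize (H x ltac:(lia)). destruct He as [<-|[<-|[]]];
      rewrite ?ev_scale, ev_var; simpl; rewrite H; lra. }
  rewrite Hk. intuition lra.
Qed.

Lemma sat_pathC k L U sts ts : length sts = length ts -> forall v w w',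
  sat (envp v w w' U) (pathC k L (combine sts ts)) <-> path_run k (Q2R L) U sts ts v w w'.
Proof.
  revert ts. induction sts as [|s sts IH]; intros [|t ts] Hl v w w'; try discriminate.
  - apply sat_endC.
  - simpl combine. simpl pathC. rewrite sat_stepC. simpl in Hl. injection Hl as Hl.
    simpl path_run. split; intros (d & H0 & H1 & H2 & H3 & H4); exists d;
    repeat (split; try assumption); try (apply H1; assumption); try apply H3; now apply IH.
Qed.

Lemma map_nth_combine {S T} (l1 : list S) (l2 : list T) d1 d2 : length l1 = length l2 ->
  map (fun i => (nth i l1 d1, nth i l2 d2)) (seq 0 (length l2)) = combine l1 l2.
Proof.
  revert l2. induction l1; intros [|b l2] Hl; try discriminate; auto.
  simpl. f_equal. injection Hl as Hl. rewrite <- IHl1 by auto.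
  now rewrite <- seq_shift, map_map.
Qed.

Lemma rel_edgeC A L e w w' U : WF A -> In e (edges A) ->
  (rel (edgeC A L e) w w' U <-> etp_run A (Q2R L) U (esrc e) (epath e) w w').
Proof.
  intros (_ & _ & HW) He. destruct e as [[m m'] p]. destruct (HW m m' p He) as (_ & _ & Hl & _).
  unfold rel, edgeC, etp_run. rewrite <- sat_pathC by (simpl; lia).
  unfold steps, esrc, epath. simpl fst. simpl snd. rewrite map_nth_combine by (simpl; lia).
  unfold ren. rewrite sat_subst. split; apply sat_ext; intros [|[|[|[|y]]]]; cbn [nth envp env3];
  rewrite ?ev_var; reflexivity.
Qed.

(** Clocks do not see the energy, and raising it only relaxes the lower bound; hence [d] is
    nonnegative. *)
Lemma path_run_shift k L U U' sts ts d : 0 <= d -> U + d <= U' -> forall v w w',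
  path_run k L U sts ts v w w' -> path_run k L U' sts ts v (w + d) (w' + d).
Proof.
  intros Hd HU. revert ts. induction sts as [|s sts IH]; intros [|t ts] v w w'; simpl; auto.
  - intros [-> H]. auto.
  - intros (a & Ha & Hi & Hg & Hw & Hr). exists a. split; auto. split.
    { intros t0 Ht. destruct (Hi t0 Ht). split; auto. lra. }
    split; auto. split; [lra|].
    replace (w + d + a * Q2R (rate s) + Q2R (Defs.upd t)) with (w + a * Q2R (rate s) + Q2R (Defs.upd t) + d) by ring.
    auto.
Qed.

Lemma path_run_bounds k L U s sts ts v w w' : path_run k L U (s :: sts) ts v w w' -> L <= w <= U.
Proof.
  destruct ts; simpl; [easy|]. intros (a & Ha & Hi & _). destruct (Hi 0 ltac:(lra)) as [_ H]. lra.
Qed.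

(** * Edge paths and their runs *)

Section Runs.
Variable A : seta.
Hypothesis HA : WF A.

Fixpoint conn (m : nat) (es : list edge) (m' : nat) : Prop :=
  match es with
  | [] => m = m'
  | e :: es => In e (edges A) /\ esrc e = m /\ conn (edst e) es m'
  end.

Fixpoint run (L U : R) (es : list edge) (w w' : R) : Prop :=
  match es with
  | [] => w = w'
  | e :: es => exists v, etp_run A L U (esrc e) (epath e) w v /\ run L U es v w'
  end.

Lemma conn_app m es1 es2 m' : conn m (es1 ++ es2) m' <-> exists x, conn m es1 x /\ conn x es2 m'.
Proof.
  revert m. induction es1 as [|e es1 IH]; intros m; simpl.
  - split; [eauto|]. intros [x [-> H]]. auto.
  - rewrite IH. firstorder.
Qed.

Lemma run_app L U es1 es2 w w' : run L U (es1 ++ es2) w w' <-> exists x, run L U es1 w x /\ run L U es2 x w'.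
Proof.
  revert w. induction es1 as [|e es1 IH]; intros w; simpl.
  - split; [eauto|]. intros [x [-> H]]. auto.
  - split.
    + intros (v & Hv & H). apply IH in H as (x & H1 & H2). exists x. split; auto. exists v. auto.
    + intros (x & (v & Hv & H1) & H2). exists v. split; auto. apply IH. exists x. auto.
Qed.

Lemma run_shift L U U' es d w w' : 0 <= d -> U + d <= U' ->
  run L U es w w' -> run L U' es (w + d) (w' + d).
Proof.
  intros Hd HU. revert w. induction es as [|e es IH]; intros w; simpl.
  - intros ->. auto.
  - intros (v & Hv & H). exists (v + d). split; auto. unfold etp_run. eapply path_run_shift; eauto.
Qed.

Lemma run_mono L U U' es w w' : U <= U' -> run L U es w w' -> run L U' es w w'.
Proof.
  intros HU H. apply (run_shift L U U' es 0) in H; try lra. now rewrite !Rplus_0_r in H.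
Qed.

Lemma etp_run_bounds L U m p w w' : etp_run A L U m p w w' -> L <= w <= U.
Proof. apply path_run_bounds. Qed.

(** * Correctness of the formulas *)

Variable L : Q.
Let G := graph A L.

Lemma in_pathsC_sound m n F m' : In (F, m') (pathsC G m n) ->
  exists es, length es = n /\ conn m es m' /\ forall w w' U, rel F w w' U <-> run (Q2R L) U es w w'.
Proof.
  revert F m'. induction n; intros F m' H.
  - destruct H as [H|[]]. injection H as <- <-. exists []. repeat split; simpl; intros.
    + apply rel_idC in H. auto. + apply rel_idC. auto.
  - simpl in H. apply in_flat_map in H as [[F0 m0] [H0 H]]. apply in_flat_map in H as [[[a b] Fe] [Hg H]].
    simpl in H. destruct (Nat.eqb_spec a m0); [|destruct H]. destruct H as [H|[]].
    injection H as <- <-. subst m0. apply IHn in H0 as (es & Hl & Hc & Hr).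
    unfold G, graph in Hg. apply in_map_iff in Hg as (e & Hg & He). injection Hg as <- <- <-.
    exists (es ++ [e]). split; [|split].
    + rewrite length_app. simpl. lia.
    + apply conn_app. exists (esrc e). simpl. auto.
    + intros. rewrite rel_compC, run_app. simpl. split.
      * intros (v & H1 & H2). exists v. split; [now apply Hr|]. apply rel_edgeC in H2; eauto.
      * intros (v & H1 & x & H2 & ->). exists v. split; [now apply Hr|]. apply rel_edgeC; eauto.
Qed.

Lemma in_pathsC_complete m es m' : conn m es m' ->
  exists F, In (F, m') (pathsC G m (length es)) /\ forall w w' U, rel F w w' U <-> run (Q2R L) U es w w'.
Proof.
  revert m'. induction es as [|e es IH] using rev_ind; intros m' H.
  - simpl in H. subst m'. exists idC. split; [simpl; auto|]. intros. rewrite rel_idC. simpl. intuition.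
  - apply conn_app in H as (x & H1 & He & Hs & H2). simpl in H2. subst.
    apply IH in H1 as (F & HF & Hr). exists (compC F (edgeC A L e)). split.
    + rewrite length_app, Nat.add_comm. simpl. apply in_flat_map. exists (F, esrc e). split; auto.
      apply in_flat_map. exists (esrc e, edst e, edgeC A L e). split.
      * unfold G, graph. apply in_map_iff. exists e. auto.
      * simpl. rewrite Nat.eqb_refl. simpl; auto.
    + intros. rewrite rel_compC, run_app. simpl. split.
      * intros (v & Ha & Hb). exists v. split; [now apply Hr|]. apply rel_edgeC in Hb; eauto.
      * intros (v & Ha & y & Hb & ->). exists v. split; [now apply Hr|]. apply rel_edgeC; eauto.
Qed.

(** The quantification over [U] matters: the same system is reused after shifts that change the
    bound. *)
Definition represents (F : list lin) (es : list edge) : Prop :=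
  forall w w' U, rel F w w' U <-> run (Q2R L) U es w w'.

Lemma in_pathsC_upto N m F m' : In (F, m') (pathsC_upto G N m) ->
  exists es, conn m es m' /\ represents F es.
Proof.
  unfold pathsC_upto. intros H. apply in_flat_map in H as [n [_ H]].
  apply in_pathsC_sound in H as (es & _ & H). eauto.
Qed.

Lemma pathsC_upto_complete N m es m' : (length es <= N)%nat -> conn m es m' ->
  exists F, In (F, m') (pathsC_upto G N m) /\ represents F es.
Proof.
  intros Hl H. apply in_pathsC_complete in H as (F & HF & Hr). exists F. split; auto.
  unfold pathsC_upto. apply in_flat_map. exists (length es). split; auto. apply in_seq. lia.
Qed.

Lemma in_loopsC N m F : In F (loopsC G N m) ->
  exists es, es <> [] /\ conn m es m /\ represents F es.
Proof.
  unfold loopsC. intros H. apply in_map_iff in H as [[F' m'] [<- H]].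
  apply filter_In in H as [H Hm]. apply Nat.eqb_eq in Hm. simpl in Hm. subst m'.
  apply in_flat_map in H as [n [Hn H]]. apply in_seq in Hn.
  apply in_pathsC_sound in H as (es & Hl & H). exists es. split; [|auto].
  intros ->. simpl in Hl. lia.
Qed.

Lemma loopsC_complete N m es : es <> [] -> (length es <= N)%nat -> conn m es m ->
  exists F, In F (loopsC G N m) /\ represents F es.
Proof.
  intros Hn Hl H. apply in_pathsC_complete in H as (F & HF & Hr). exists F. split; auto.
  unfold loopsC. apply in_map_iff. exists (F, m). split; auto. apply filter_In.
  split; [|apply Nat.eqb_refl]. apply in_flat_map. exists (length es). split; auto. apply in_seq.
  destruct es; [congruence|simpl in *; lia].
Qed.

(** Coinduction for infinite runs: dependent choice iterates a step that preserves the invariant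
    [J]. *)
Lemma inf_run_coind (J : nat -> R -> Prop) l U :
  (forall m w, J m w -> exists p m' w', In (m, m', p) (edges A) /\ etp_run A l U m p w w' /\ J m' w') ->
  forall m w, J m w -> inf_run A m w l U.
Proof.
  intros HJ m w Hmw.
  assert (HJ' : forall c : {c : nat * R | J (fst c) (snd c)}, exists c' : {c : nat * R | J (fst c) (snd c)},
    exists p, In (fst (proj1_sig c), fst (proj1_sig c'), p) (edges A) /\
      etp_run A l U (fst (proj1_sig c)) p (snd (proj1_sig c)) (snd (proj1_sig c'))).
  { intros [[a x] Hc]. destruct (HJ a x Hc) as (p & m' & w' & H1 & H2 & H3).
    exists (exist _ (m', w') H3). exists p. auto. }
  set (next c := proj1_sig (constructive_indefinite_description _ (HJ' c))).
  set (s n := Nat.iter n next (exist _ (m, w) Hmw)).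
  exists (fun n => fst (proj1_sig (s n))), (fun n => snd (proj1_sig (s n))).
  split; [reflexivity|]. split; [reflexivity|]. intros i.
  change (s (S i)) with (next (s i)). unfold next.
  exact (proj2_sig (constructive_indefinite_description _ (HJ' (s i)))).
Qed.

(** The invariant carries a pending path that ends at [m] with energy in the stable interval. Its
    edges are consumed one at a time, and when it is empty it is refilled with the loop [es2]. *)
Lemma inf_run_of_win m0 w0 es1 m w es2 F U : conn m0 es1 m -> run (Q2R L) U es1 w0 w ->
  es2 <> [] -> conn m es2 m -> represents F es2 -> win F w U -> inf_run A m0 w0 (Q2R L) U.
Proof.
  intros C1 R1 N2 C2 HF (a & b & a' & b' & Hw & Ha & Hb & Ra & Rb).
  apply (inf_run_coind (fun m' x => exists es y, conn m' es m /\ run (Q2R L) U es x y /\ a <= y <= b)).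
  - assert (Hcons : forall m' x es y, es <> [] -> conn m' es m -> run (Q2R L) U es x y -> a <= y <= b ->
      exists p m'' w', In (m', m'', p) (edges A) /\ etp_run A (Q2R L) U m' p x w' /\
        exists es y, conn m'' es m /\ run (Q2R L) U es w' y /\ a <= y <= b).
    { intros m' x [|e es] y Hn HC HR Hy; [congruence|]. destruct HC as (He & <- & HC).
      destruct HR as (v & Hv & HR). exists (epath e), (edst e), v.
      split; [destruct e as [[? ?] ?]; exact He|]. split; eauto. }
    intros m' x (es & y & HC & HR & Hy). destruct es as [|e es].
    + simpl in HC, HR. subst.
      destruct (stable_interval F U a b a' b' y Ha Hb Ra Rb Hy) as [w' [Hw' Rw]].
      apply (Hcons m y es2 w'); auto. now apply HF.
    + apply (Hcons m' x (e :: es) y); auto. discriminate.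
  - eauto.
Qed.
(** * Completeness on flat graphs *)

Lemma win_shift F es w U U' d : represents F es -> 0 <= d -> U + d <= U' -> win F w U -> win F (w + d) U'.
Proof.
  intros HF Hd HU (a & b & a' & b' & Hw & Ha & Hb & Ra & Rb).
  exists (a + d), (b + d), (a' + d), (b' + d). repeat split; try lra;
  apply HF; eapply run_shift; eauto; now apply HF.
Qed.

(** Each further round is the first round shifted by the gain accumulated so far, so the upper bound
    grows with [n]. *)
Lemma run_iterate m es U w g n : conn m es m -> run (Q2R L) U es w (w + g) -> 0 <= g ->
  exists es' U', U <= U' /\ conn m es' m /\ run (Q2R L) U' es' w (w + INR n * g).
Proof.
  intros HC HR Hg. induction n.
  - exists [], U. simpl. repeat split; lra.
  - destruct IHn as (es' & U' & HU & HC' & HR'). set (d := INR n * g) in *.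
    assert (Hd : 0 <= d) by (apply Rmult_le_pos; auto using pos_INR).
    exists (es' ++ es), (U' + d). split; [lra|]. split; [apply conn_app; eauto|].
    apply run_app. exists (w + d). split.
    + eapply run_mono; [|exact HR']. lra.
    + replace (w + INR (S n) * g) with (w + g + d) by (rewrite S_INR; unfold d; ring).
      apply (run_shift _ U); auto. lra.
Qed.

Lemma inf_run_mono m w l U U' : U <= U' -> inf_run A m w l U -> inf_run A m w l U'.
Proof.
  intros HU (ms & en & H0 & H1 & H). exists ms, en. repeat split; auto.
  intros i. destruct (H i) as (p & Hp & Hr). exists p. split; auto. unfold etp_run in *.
  apply (path_run_shift _ _ U U' _ _ 0) in Hr; try lra. now rewrite !Rplus_0_r in Hr.
Qed.

Let N := length (mstates A).

Lemma bound_formulas_sound m0 w0 F U : In F (bound_formulas G N m0 w0) -> sat (env1 U) F ->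
  inf_run A m0 (Q2R w0) (Q2R L) U.
Proof.
  unfold bound_formulas. intros HF Hs. apply in_flat_map in HF as [[F1 m] [H1 HF]].
  apply in_map_iff in HF as (F2 & <- & H2). apply sat_boundC in Hs as (w & Hr & Hw).
  apply in_pathsC_upto in H1 as (es1 & C1 & R1). apply in_loopsC in H2 as (es2 & N2 & C2 & R2).
  eapply inf_run_of_win; eauto. now apply R1.
Qed.

Lemma direct_formulas_sound m0 w0 F t : In F (direct_formulas G N m0 w0) -> sat (env1 t) F ->
  exists U, inf_run A m0 (Q2R w0) (Q2R L) U.
Proof.
  unfold direct_formulas. intros HF Hs. apply in_flat_map in HF as [[F1 m] [H1 HF]].
  apply in_map_iff in HF as (F2 & <- & H2). apply sat_directC in Hs as (_ & U & w & Hr & Hw).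
  apply in_pathsC_upto in H1 as (es1 & C1 & R1). apply in_loopsC in H2 as (es2 & N2 & C2 & R2).
  exists U. eapply inf_run_of_win; eauto. now apply R1.
Qed.

(* Iterating the energy-increasing loop enough times lifts the run [x -> y] and the final loop. *)
Lemma boost_formulas_sound m0 w0 F t : In F (boost_formulas G N m0 w0) -> sat (env1 t) F -> t < 0 ->
  exists U, inf_run A m0 (Q2R w0) (Q2R L) U.
Proof.
  unfold boost_formulas. intros HF Hs Ht. apply in_flat_map in HF as [[F1 m1] [H1 HF]].
  apply in_flat_map in HF as [F2 [H2 HF]]. apply in_flat_map in HF as [[F3 m] [H3 HF]].
  apply in_map_iff in HF as (F4 & <- & H4). simpl in *.
  apply sat_boostC in Hs as (_ & U & w1 & w2 & x & y & Hg & Q1 & Q2 & Q3 & Hw).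
  apply in_pathsC_upto in H1 as (es1 & C1 & R1). apply in_loopsC in H2 as (es2 & N2 & C2 & R2).
  apply in_pathsC_upto in H3 as (es3 & C3 & R3). apply in_loopsC in H4 as (es4 & N4 & C4 & R4).
  apply R1 in Q1. apply R2 in Q2. apply R3 in Q3.
  set (g := w2 - w1) in *. assert (Hpos : 0 < g) by (unfold g; lra).
  destruct (INR_unbounded ((x - w1) / g)) as [n Hn].
  assert (Hx : x - w1 <= INR n * g).
  { apply Rmult_lt_compat_r with (r := g) in Hn; auto.
    replace ((x - w1) / g * g) with (x - w1) in Hn by (field; lra). lra. }
  replace w2 with (w1 + g) in Q2 by (unfold g; ring).
  destruct (run_iterate m1 es2 U w1 g n C2 Q2) as (es & U' & HU & HC & HR); [lra|].
  (* Repetition overshoots [x] in general; the surplus [d] is passed on by shifting all that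
     follows. *)
  set (d := w1 + INR n * g - x) in *. assert (Hd : 0 <= d) by (unfold d; lra).
  exists (U' + d).
  apply (inf_run_of_win m0 _ (es1 ++ es ++ es3) m (y + d) es4 F4); auto.
  - apply conn_app. exists m1. split; auto. apply conn_app. eauto.
  - apply run_app. exists w1. split; [eapply run_mono; [|eauto]; lra|].
    apply run_app. exists (x + d). split.
    + replace (x + d) with (w1 + INR n * g) by (unfold d; ring). eapply run_mono; [|eauto]; lra.
    + apply (run_shift _ U); auto. lra.
  - apply (win_shift F4 es4 y U); auto. lra.
Qed.

Lemma nodup_map_inj {S T} (f : S -> T) l x y : NoDup (map f l) -> In x l -> In y l -> f x = f y -> x = y.
Proof.
  induction l as [|a l IH]; simpl; intros Hd Hx Hy Hf; [contradiction|].
  inversion Hd as [|? ? Hn Hd']; subst.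
  destruct Hx as [->|Hx], Hy as [->|Hy]; auto; exfalso; apply Hn.
  - rewrite Hf. now apply in_map.
  - rewrite <- Hf. now apply in_map.
Qed.

(** Makes an infinite run determined at the level of edges by its macro-states, so that a periodic
    vertex sequence repeats the same segment. *)
Lemma etp_unique m m' p q : In (m, m', p) (edges A) -> In (m, m', q) (edges A) -> p = q.
Proof.
  intros Hp Hq. destruct HA as (_ & Hd & _).
  assert (Ee : (m, m', p) = (m, m', q)) by (eapply nodup_map_inj; eauto). congruence.
Qed.

(** * Segments of an infinite run *)

Section InfiniteRun.
Variables (ms : nat -> nat) (en : nat -> R) (P : nat -> etp) (U : R).
Hypothesis HP : forall i, In (ms i, ms (S i), P i) (edges A) /\
  etp_run A (Q2R L) U (ms i) (P i) (en i) (en (S i)).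

Definition segment (i n : nat) : list edge := map (fun k => (ms k, ms (S k), P k)) (seq i n).

Lemma conn_segment i n : conn (ms i) (segment i n) (ms (i + n)).
Proof.
  revert i. induction n; intros i; simpl.
  - now rewrite Nat.add_0_r.
  - split; [apply HP|]. split; auto. unfold edst. simpl. rewrite Nat.add_succ_r. apply (IHn (S i)).
Qed.

Lemma run_segment i n : run (Q2R L) U (segment i n) (en i) (en (i + n)%nat).
Proof.
  revert i. induction n; intros i; simpl.
  - now rewrite Nat.add_0_r.
  - exists (en (S i)). split; [apply HP|]. rewrite Nat.add_succ_r. apply (IHn (S i)).
Qed.

Lemma segment_ext i j n : (forall k, (k <= n)%nat -> ms (i + k) = ms (j + k)) -> segment i n = segment j n.
Proof.
  revert i j. induction n; intros i j H; auto.
  apply (f_equal2 (fun e es => e :: es) (x1 := (ms i, ms (S i), P i)) (y1 := (ms j, ms (S j), P j))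
    (x2 := segment (S i) n) (y2 := segment (S j) n)).
  - assert (E0 := H 0%nat ltac:(lia)). assert (E1 := H 1%nat ltac:(lia)).
    rewrite !Nat.add_0_r in E0. rewrite !Nat.add_1_r in E1.
    assert (EP : P i = P j); [|now rewrite E0, E1, EP].
    apply (etp_unique (ms i) (ms (S i))); [apply HP|]. rewrite E0, E1. apply HP.
  - apply IHn. intros k Hk. specialize (H (S k) ltac:(lia)). now rewrite !Nat.add_succ_r in H.
Qed.

(** Sampling the energy once per period gives an infinite bounded iteration of the single relation
    [F]. *)
Lemma win_of_period i l F : (forall k, ms (i + k + l) = ms (i + k)) ->
  represents F (segment i l) -> win F (en i) U.
Proof.
  intros Hp HF. replace (en i) with (en (i + 0 * l)%nat) by (f_equal; lia).
  assert (Hper : forall n k, ms (i + n * l + k) = ms (i + k)).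
  { induction n; intros k; [f_equal; lia|]. rewrite <- IHn.
    replace (i + n * l + k)%nat with (i + (n * l + k))%nat by lia. rewrite <- Hp. f_equal. lia. }
  apply (win_of_sequence F U (Q2R L) (fun n => en (i + n * l)%nat)).
  - intros n. eapply etp_run_bounds, HP.
  - intros n. apply HF. rewrite (segment_ext i (i + n * l)) by auto.
    replace (i + S n * l)%nat with (i + n * l + l)%nat by lia. apply run_segment.
Qed.

Lemma ms_bound i : (ms i < N)%nat.
Proof. destruct HA as (_ & _ & H). destruct (HP i) as [Hi _]. apply H in Hi as [Hi _]. exact Hi. Qed.

Lemma ms_E i : E A (ms i) (ms (S i)).
Proof. exists (P i). apply HP. Qed.

End InfiniteRun.

(** * Repetitions and first returns in flat graphs *)

Lemma nodup_bounded_length l n : NoDup l -> (forall x, In x l -> (x < n)%nat) -> (length l <= n)%nat.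
Proof.
  intros Hd Hb. rewrite <- (length_seq n 0). apply NoDup_incl_length; auto.
  intros x Hx. apply in_seq. specialize (Hb x Hx). lia.
Qed.

Lemma first_repetition (c : list nat) : ~ NoDup c ->
  exists l1 x l2 l3, c = l1 ++ x :: l2 ++ x :: l3 /\ ~ In x l2.
Proof.
  induction c as [|a c IH]; intros H. { destruct H. constructor. }
  destruct (in_dec Nat.eq_dec a c) as [Hi|Hi].
  - assert (exists l2 l3, c = l2 ++ a :: l3 /\ ~ In a l2) as (l2 & l3 & -> & Hn).
    { clear -Hi. induction c as [|b c IH]; [destruct Hi|].
      destruct (Nat.eq_dec b a) as [->|Hb].
      - exists [], c. split; auto.
      - destruct Hi as [|Hi]; [congruence|]. destruct (IH Hi) as (l2 & l3 & -> & Hn).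
        exists (b :: l2), l3. split; auto. intros [|]; auto. }
    exists [], a, l2, l3. auto.
  - destruct IH as (l1 & x & l2 & l3 & -> & Hn). { intros Hd. apply H. constructor; auto. }
    exists (a :: l1), x, l2, l3. auto.
Qed.

(** [y] is the vertex entered after the last one of [c]; taking for it the head of [c] makes the
    walk closed. *)
Fixpoint walk (c : list nat) (y : nat) : Prop :=
  match c with [] => True | x :: r => E A x (hd y r) /\ walk r y end.

Lemma walk_app l1 l2 y : walk (l1 ++ l2) y <-> walk l1 (hd y l2) /\ walk l2 y.
Proof.
  induction l1 as [|a l1 IH]; simpl; [tauto|]. rewrite IH. destruct l1; simpl; tauto.
Qed.

Lemma simple_cycle_of_walk x r : walk (x :: r) x -> NoDup (x :: r) -> simple_cycle A (x :: r).
Proof.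
  intros Hw Hd. split; [discriminate|]. split; auto.
  assert (H : forall c y, c <> [] -> walk c y ->
    (forall i, (S i < length c)%nat -> E A (nth i c 0%nat) (nth (S i) c 0%nat)) /\ E A (last c 0%nat) y).
  { induction c as [|a [|b c] IH]; intros y Hc Hy; [congruence|..].
    - simpl in *. split; [lia|tauto].
    - destruct Hy as [H1 H2]. destruct (IH y ltac:(discriminate) H2) as [H3 H4]. split; auto.
      intros [|i] Hi; [exact H1|]. apply H3. simpl in *. lia. }
  apply (H (x :: r)); [discriminate|auto].
Qed.

(* If the first vertex [x] to repeat in a first-return walk at [m] occurs twice, both the loop at [x]
   and the rest of the walk are shorter first-return walks, hence distinct simple cycles through [x]. *)
Lemma flat_first_return : flat A -> forall n m r, (length r <= n)%nat ->
  walk (m :: r) m -> ~ In m r -> NoDup (m :: r).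
Proof.
  intros Hfl. induction n; intros m r Hl Hw Hm.
  - destruct r; [|simpl in Hl; lia]. repeat constructor; auto.
  - apply NNPP. intros Hd.
    destruct (first_repetition r) as (l1 & x & l2 & l3 & -> & Hx). { intros H. apply Hd. now constructor. }
    assert (Hw' := Hw).
    change (m :: l1 ++ x :: l2 ++ x :: l3) with ((m :: l1) ++ (x :: l2) ++ (x :: l3)) in Hw.
    rewrite !walk_app in Hw. destruct Hw as (W1 & W2 & W3). simpl hd in W1, W2.
    rewrite !in_app_iff in Hm. simpl in Hm. rewrite in_app_iff in Hm. simpl in Hm.
    rewrite length_app in Hl. simpl in Hl. rewrite length_app in Hl. simpl in Hl.
    assert (D1 : NoDup (x :: l2)). { apply IHn; auto. lia. }
    assert (W : walk (m :: l1 ++ x :: l3) m).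
    { change (m :: l1 ++ x :: l3) with ((m :: l1) ++ (x :: l3)). rewrite walk_app. auto. }
    assert (D2 : NoDup (m :: l1 ++ x :: l3)).
    { apply IHn; auto. rewrite length_app. simpl. lia. rewrite in_app_iff. simpl. tauto. }
    destruct (Hfl x (x :: l2) (m :: l1 ++ x :: l3)) as (a & b & Ea & Eb);
      try apply simple_cycle_of_walk; auto.
    + simpl; auto.
    + right. rewrite in_app_iff. simpl; auto.
    (* Rotations have the same elements, so [m] would occur in the loop at [x], against the
       first-return hypothesis. *)
    + assert (In m (x :: l2)); [|simpl in *; tauto].
      rewrite Ea. assert (In m (b ++ a)) as Hi by (rewrite <- Eb; simpl; auto).
      rewrite in_app_iff in *. tauto.
Qed.

(** A proper rotation would start at an element of [r1], and [m] is not repeated there. *)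
Lemma rotation_same_head m r1 r2 : rotation (m :: r1) (m :: r2) -> NoDup (m :: r1) -> m :: r1 = m :: r2.
Proof.
  intros (a & b & Ea & Eb) Hd. destruct a as [|x a]; [now rewrite Ea, Eb, app_nil_r|].
  destruct b as [|y b]; [now rewrite Ea, Eb, app_nil_r|].
  simpl in Ea, Eb. injection Ea as -> Er. injection Eb as -> _. exfalso.
  inversion Hd as [|? ? Hn _]. apply Hn. rewrite Er. apply in_or_app. simpl; auto.
Qed.

(** Infinite pigeonhole: either the largest value recurs forever, or it disappears from some tail,
    which takes fewer values. *)
Lemma infinitely_often n (f : nat -> nat) : (forall i, (f i < n)%nat) ->
  exists m, forall i, exists j, (i <= j)%nat /\ f j = m.
Proof.
  revert f. induction n; intros f H.
  - specialize (H 0%nat). lia.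
  - destruct (classic (forall i, exists j, (i <= j)%nat /\ f j = n)) as [Hn|Hn]; [eauto|].
    apply not_all_ex_not in Hn as [i0 Hi].
    destruct (IHn (fun k => f (i0 + k)%nat)) as [m Hm].
    { intros k. specialize (H (i0 + k)%nat). assert (f (i0 + k)%nat <> n); [|lia].
      intros Hk. apply Hi. exists (i0 + k)%nat. split; auto. lia. }
    exists m. intros i. destruct (Hm i) as (j & Hj & Hf). exists (i0 + j)%nat. split; auto. lia.
Qed.

Lemma flat_period (ms : nat -> nat) : flat A -> (forall i, E A (ms i) (ms (S i))) ->
  (forall i, (ms i < N)%nat) ->
  exists i l, (0 < l <= N)%nat /\ forall k, ms (i + k + l)%nat = ms (i + k)%nat.
Proof.
  intros Hfl HE HN. destruct (infinitely_often N ms HN) as [m Hm].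
  assert (Hret : forall i, ms i = m -> exists l, (0 < l)%nat /\ ms (i + l)%nat = m /\
     simple_cycle A (map ms (seq i l))).
  { intros i Hi.
    assert (Hmin : exists l, (0 < l)%nat /\ ms (i + l)%nat = m /\
      forall k, (0 < k < l)%nat -> ms (i + k)%nat <> m).
    { destruct (Hm (S i)) as (j & Hj & Hjm).
      assert (Hex : exists l, (0 < l)%nat /\ ms (i + l)%nat = m).
      { exists (j - i)%nat. split; [lia|]. now replace (i + (j - i))%nat with j by lia. }
      destruct Hex as [l Hl]. revert Hl. induction l as [l IH] using lt_wf_ind. intros Hl.
      destruct (classic (exists k, (0 < k < l)%nat /\ ms (i + k)%nat = m)) as [(k & Hk & Hkm)|Hn].
      - apply (IH k); [lia|]. split; [lia|auto].
      - exists l. repeat split; try apply Hl. intros k Hk Hkm. apply Hn. eauto. }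
    destruct Hmin as (l & Hl & Hlm & Hmin). exists l. split; [auto|]. split; [auto|].
    assert (Hw : forall n j, walk (map ms (seq j n)) (ms (j + n)%nat)).
    { induction n; intros j; simpl; auto. rewrite Nat.add_succ_r. split; [|apply (IHn (S j))].
      destruct n; simpl; [rewrite Nat.add_0_r|]; apply HE. }
    specialize (Hw l i). destruct l; [lia|]. simpl seq in *. simpl map in *. rewrite Hlm, Hi in *.
    apply simple_cycle_of_walk; auto. apply (flat_first_return Hfl (length (map ms (seq (S i) l)))); auto.
    intros Hin. apply in_map_iff in Hin as (k & Hk & Hs). apply in_seq in Hs.
    apply (Hmin (k - i)%nat); [lia|]. now replace (i + (k - i))%nat with k by lia. }
  destruct (Hm 0%nat) as (i & _ & Hi). destruct (Hret i Hi) as (l & Hl & Hil & Hc).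
  exists i, l.
  (* The first-return walks at two visits of [m] are simple cycles through [m], hence rotations with
     the same head, hence equal; in particular the return time is always [l]. *)
  assert (Hsame : forall j, ms j = m -> ms (j + l)%nat = m /\ map ms (seq j l) = map ms (seq i l)).
  { intros j Hj. destruct (Hret j Hj) as (l' & Hl' & Hjl & Hc').
    assert (Ec : map ms (seq i l) = map ms (seq j l')).
    { destruct l, l'; try lia. simpl seq in *. simpl map in *. rewrite Hi, Hj in *.
      apply rotation_same_head; [|apply Hc]. apply (Hfl m); simpl; auto. }
    assert (l = l') as <-. { apply (f_equal (@length nat)) in Ec. now rewrite !length_map, !length_seq in Ec. }
    auto. }
  assert (Hn : forall n, ms (i + n * l)%nat = m).
  { induction n; [now replace (i + 0 * l)%nat with i by lia|].
    replace (i + S n * l)%nat with (i + n * l + l)%nat by lia. now apply Hsame. }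
  assert (Hk : forall n k, (k < l)%nat -> ms (i + n * l + k)%nat = ms (i + k)%nat).
  { intros n k Hk. destruct (Hsame _ (Hn n)) as [_ He].
    apply (f_equal (fun c => nth_error c k)) in He. rewrite !nth_error_map in He.
    rewrite !nth_error_seq in He. destruct (Nat.ltb_spec k l); [|lia]. simpl in He. congruence. }
  split.
  (* The period is the length of a simple cycle, whose macro-states are distinct. *)
  - split; auto. rewrite <- (length_seq l i), <- (length_map ms). apply nodup_bounded_length; [apply Hc|].
    intros x Hx. apply in_map_iff in Hx as (k & <- & _). auto.
  - intros k. rewrite (Nat.div_mod k l) by lia.
    assert (k mod l < l)%nat by (apply Nat.mod_upper_bound; lia).
    replace (i + (l * (k / l) + k mod l) + l)%nat with (i + (S (k / l)) * l + k mod l)%nat by lia.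
    replace (i + (l * (k / l) + k mod l))%nat with (i + (k / l) * l + k mod l)%nat by lia.
    now rewrite !Hk.
Qed.

(** * Cutting loops out of finite paths *)

Lemma conn_dup m es m' : conn m es m' -> ~ NoDup (m :: map edst es) ->
  exists x e1 e2 e3, es = e1 ++ e2 ++ e3 /\ e2 <> [] /\ conn m e1 x /\ conn x e2 x /\ conn x e3 m'.
Proof.
  revert m. induction es as [|e es IH]; intros m HC Hd.
  - exfalso. apply Hd. repeat constructor. intros [].
  - destruct (in_dec Nat.eq_dec m (map edst (e :: es))) as [Hi|Hi].
    + apply in_map_iff in Hi as (f & Hf & Hin). apply in_split in Hin as (e2 & e3 & Eq).
      exists m, [], (e2 ++ [f]), e3. rewrite Eq, <- app_assoc in *. split; [reflexivity|].
      split; [now destruct e2|]. simpl app in *.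
      apply conn_app in HC as (y & H1 & H2 & H3 & H4). rewrite Hf in H4.
      repeat split; auto. apply conn_app. exists y. split; auto. simpl. subst. auto.
    + destruct HC as (He & Hs & HC).
      destruct (IH _ HC) as (x & e1 & e2 & e3 & -> & Hn & H1 & H2 & H3).
      { intros Hd'. apply Hd. constructor; auto. }
      exists x, (e :: e1), e2, e3. simpl. split; [reflexivity|]. tauto.
Qed.

Lemma conn_bound m es m' e : conn m es m' -> In e es -> (esrc e < N)%nat /\ (edst e < N)%nat.
Proof.
  revert m. induction es as [|f es IH]; intros m HC Hi; [destruct Hi|].
  destruct HC as (Hf & _ & HC). destruct Hi as [->|Hi]; eauto.
  destruct HA as (_ & _ & HW). destruct e as [[a b] p]. apply HW in Hf. unfold nms in Hf. simpl. tauto.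
Qed.

(** The loop is sought among the first [N] edges, which already visit [N + 1] vertices. This bounds
    [e1] and [e2] together, as needed when the loop is kept for boosting. *)
Lemma conn_long m es m' : conn m es m' -> (N < length es)%nat ->
  exists x e1 e2 e3, es = e1 ++ e2 ++ e3 /\ e2 <> [] /\ (length e1 + length e2 <= N)%nat /\
    conn m e1 x /\ conn x e2 x /\ conn x e3 m'.
Proof.
  intros HC Hl. rewrite <- (firstn_skipn N es) in HC |- *.
  assert (HC' := HC). apply conn_app in HC as (y & H1 & H2).
  destruct (conn_dup _ _ _ H1) as (x & e1 & e2 & e3 & Eq & Hn & C1 & C2 & C3).
  { intros Hd. apply nodup_bounded_length with (n := N) in Hd.
    - simpl in Hd. rewrite length_map, length_firstn in Hd. lia.
    - intros z [<-|Hz].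
      + destruct es as [|e es]; [simpl in Hl; lia|]. rewrite firstn_skipn in HC'.
        assert (Hb := conn_bound _ _ _ e HC' ltac:(simpl; auto)). destruct HC' as (_ & <- & _). tauto.
      + apply in_map_iff in Hz as (e & <- & He). apply (conn_bound _ _ _ _ H1 He). }
  exists x, e1, e2, (e3 ++ skipn N es). rewrite Eq, !app_assoc. split; auto. split; auto. split.
  - apply (f_equal (@length edge)) in Eq. rewrite !length_app, length_firstn in Eq. lia.
  - repeat split; auto. apply conn_app. eauto.
Qed.

(** With a free starting energy every loop can be removed: the suffix is raised if the loop loses
    energy, the prefix if it gains. Either way the final energy does not drop, so a win at the end
    can be shifted along. *)
Lemma shorten n : forall m es m' x w U, (length es <= n)%nat -> conn m es m' -> run (Q2R L) U es x w ->
  exists es' x' w' U', (length es' <= N)%nat /\ conn m es' m' /\ run (Q2R L) U' es' x' w' /\ w <= w'.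
Proof.
  induction n; intros m es m' x w U Hl HC HR.
  - exists es, x, w, U. repeat split; auto; try lra. lia.
  - destruct (le_lt_dec (length es) N) as [Hs|Hs]. { exists es, x, w, U. repeat split; auto; lra. }
    destruct (conn_long _ _ _ HC Hs) as (y & e1 & e2 & e3 & -> & Hn & _ & C1 & C2 & C3).
    apply run_app in HR as (a & R1 & HR). apply run_app in HR as (b & R2 & R3).
    assert (Hl' : (length (e1 ++ e3) <= n)%nat).
    { rewrite !length_app in *. destruct e2; [congruence|]. simpl in *. lia. }
    assert (HC' : conn m (e1 ++ e3) m') by (apply conn_app; eauto).
    destruct (Rle_dec b a) as [Hba|Hba].
    + destruct (IHn m (e1 ++ e3) m' x (w + (a - b)) (U + (a - b))) as (es' & x' & w' & U' & H); auto.
      { apply run_app. exists a. split; [eapply run_mono; [|eauto]; lra|].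
        apply (run_shift _ _ (U + (a - b)) _ (a - b)) in R3; try lra.
        now replace (b + (a - b)) with a in R3 by ring. }
      exists es', x', w', U'. intuition lra.
    + destruct (IHn m (e1 ++ e3) m' (x + (b - a)) w (U + (b - a))) as (es' & x' & w' & U' & H); auto.
      { apply run_app. exists b. split; [|eapply run_mono; [|eauto]; lra].
        apply (run_shift _ _ (U + (b - a)) _ (b - a)) in R1; try lra.
        now replace (a + (b - a)) with b in R1 by ring. }
      exists es', x', w', U'. intuition lra.
Qed.

(** Here the start [w0] is fixed, so only a loop without gain may be cut, by raising what follows.
    At the first gaining loop the process stops: that loop is kept as the booster, and the remainder
    may be shortened freely. *)
Lemma reduce_prefix F lp n : represents F lp -> forall m0 es m w0 w U, (length es <= n)%nat ->
  conn m0 es m -> run (Q2R L) U es w0 w -> win F w U ->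
  (exists es1 w1 U1, (length es1 <= N)%nat /\ conn m0 es1 m /\ run (Q2R L) U1 es1 w0 w1 /\ win F w1 U1) \/
  (exists m1 e1 e2 e3 U1 w1 w2 x y,
     (length e1 <= N)%nat /\ (length e2 <= N)%nat /\ (length e3 <= N)%nat /\ e2 <> [] /\
     conn m0 e1 m1 /\ conn m1 e2 m1 /\ conn m1 e3 m /\ w1 < w2 /\
     run (Q2R L) U1 e1 w0 w1 /\ run (Q2R L) U1 e2 w1 w2 /\ run (Q2R L) U1 e3 x y /\ win F y U1).
Proof.
  intros HF. induction n; intros m0 es m w0 w U Hl HC HR HW.
  - left. exists es, w, U. repeat split; auto. lia.
  - destruct (le_lt_dec (length es) N) as [Hs|Hs]. { left. exists es, w, U. auto. }
    destruct (conn_long _ _ _ HC Hs) as (y & e1 & e2 & e3 & -> & Hn & Hle & C1 & C2 & C3).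
    apply run_app in HR as (a & R1 & HR). apply run_app in HR as (b & R2 & R3).
    destruct (Rle_dec b a) as [Hba|Hba].
    + apply (IHn m0 (e1 ++ e3) m w0 (w + (a - b)) (U + (a - b))).
      * rewrite !length_app in *. destruct e2; [congruence|]. simpl in *. lia.
      * apply conn_app; eauto.
      * apply run_app. exists a. split; [eapply run_mono; [|eauto]; lra|].
        apply (run_shift _ _ (U + (a - b)) _ (a - b)) in R3; try lra.
        now replace (b + (a - b)) with a in R3 by ring.
      * eapply win_shift; eauto; lra.
    + right. destruct (shorten _ _ _ _ _ _ _ (le_n _) C3 R3) as (e3' & x' & w' & U' & L3 & C3' & R3' & Hw').
      (* A common bound for the pieces: it covers the shifted win and, since [w <= w'], also the
         original bound [U]. *)
      set (U1 := Rmax U' (U + (w' - w))).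
      assert (U' <= U1) by apply Rmax_l. assert (U + (w' - w) <= U1) by apply Rmax_r.
      exists y, e1, e2, e3', U1, a, b, x', w'. split; [lia|]. split; [lia|].
      repeat (split; [assumption || lra || (eapply run_mono; [|eassumption]; lra)|]).
      replace w' with (w + (w' - w)) by ring. eapply win_shift; eauto. lra.
Qed.

Lemma inf_run_choice m0 w0 U : inf_run A m0 w0 (Q2R L) U ->
  exists ms en P, ms 0%nat = m0 /\ en 0%nat = w0 /\ forall i, In (ms i, ms (S i), P i) (edges A) /\
  etp_run A (Q2R L) U (ms i) (P i) (en i) (en (S i)).
Proof.
  intros (ms & en & H0 & H1 & H).
  exists ms, en, (fun i => proj1_sig (constructive_indefinite_description _ (H i))).
  repeat split; auto; apply (proj2_sig (constructive_indefinite_description _ (H i))).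
Qed.

Lemma formulas_complete m0 w0 U : flat A -> inf_run A m0 (Q2R w0) (Q2R L) U ->
  exists F t, In F (direct_formulas G N m0 w0 ++ boost_formulas G N m0 w0) /\ sat (env1 t) F /\ t < 0.
Proof.
  intros Hfl Hrun. apply inf_run_choice in Hrun as (ms & en & P & <- & H0 & HP).
  destruct (flat_period ms Hfl) as (i & l & Hl & Hper).
  { intros i. now apply (ms_E ms en P U). } { intros i. now apply (ms_bound ms en P U). }
  assert (Cl := conn_segment ms en P U HP i l).
  assert (Ei := Hper 0%nat). rewrite Nat.add_0_r in Ei. rewrite Ei in Cl.
  assert (Ll : length (segment ms P i l) = l) by (unfold segment; now rewrite length_map, length_seq).
  destruct (loopsC_complete N (ms i) (segment ms P i l)) as (F & HF & RF); auto.
  { intros Hn. rewrite Hn in Ll. simpl in Ll. lia. } { lia. }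
  assert (HW := win_of_period ms en P U HP i l F Hper RF).
  assert (C0 := conn_segment ms en P U HP 0 i). assert (R0 := run_segment ms en P U HP 0 i).
  simpl plus in C0, R0.
  destruct (reduce_prefix F _ _ RF _ _ _ _ _ _ (le_n _) C0 R0 HW) as
    [(es1 & w1 & U1 & L1 & C1 & R1 & W1)|
     (m1 & e1 & e2 & e3 & U1 & w1 & w2 & x & y & L1 & L2 & L3 & N2 & C1 & C2 & C3 & Hg & R1 & R2 & R3 & W1)].
  - destruct (pathsC_upto_complete N _ _ _ L1 C1) as (F1 & HF1 & RF1).
    exists (directC w0 F1 F), (-1). split; [|split; [|lra]].
    + apply in_or_app. left. apply in_flat_map. exists (F1, ms i). split; auto. apply in_map_iff. eauto.
    + apply sat_directC. split; auto. exists U1, w1. split; auto. apply RF1. congruence.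
  - destruct (pathsC_upto_complete N _ _ _ L1 C1) as (F1 & HF1 & RF1).
    destruct (loopsC_complete N _ _ N2 L2 C2) as (F2 & HF2 & RF2).
    destruct (pathsC_upto_complete N _ _ _ L3 C3) as (F3 & HF3 & RF3).
    (* The opposite of the gain, clipped at the lower bound imposed by the formula. *)
    exists (boostC w0 F1 F2 F3 F), (Rmax (-1) (w1 - w2)). split; [|split].
    + apply in_or_app. right. apply in_flat_map. exists (F1, m1). split; auto.
      apply in_flat_map. exists F2. split; auto. apply in_flat_map. exists (F3, ms i). split; auto.
      apply in_map_iff. eauto.
    + apply sat_boostC. split; [apply Rmax_l|]. exists U1, w1, w2, x, y.
      split. { pose proof (Rmax_r (-1) (w1 - w2)). lra. }
      split; [apply RF1; congruence|]. split; [now apply RF2|]. split; [now apply RF3|auto].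
    + apply Rmax_lub_lt; lra.
Qed.

(** * Depth-1 flat graphs *)

Lemma tree_no_cycle : depth1_flat A -> forall v, ~ clos_trans nat (Enl A) v v.
Proof.
  intros (r & Hr & Hroot & Hpar & Hreach & Hleaf).
  assert (Hlt : forall u v, E A u v -> (v < N)%nat).
  { intros u v [p Hp]. destruct HA as (_ & _ & HW). now apply HW in Hp as (_ & Hp & _). }
  assert (H : forall v, clos_refl_trans nat (Enl A) r v -> ~ clos_trans nat (Enl A) v v).
  (* Induction along the path from the root: a cycle through [v] enters [v] from its only parent
     [u], so it yields a cycle through [u]; at the root no edge can enter. *)
  { intros v Hv. apply clos_rt_rtn1 in Hv. induction Hv as [|u v Huv _ IH]; intros Hc.
    - apply clos_trans_tn1 in Hc. inversion Hc; eapply Hroot; eauto.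
    - apply clos_trans_tn1 in Hc.
      assert (Hu : exists u', Enl A u' v /\ clos_refl_trans nat (Enl A) v u').
      { inversion Hc; subst; [exists v; split; auto; apply rt_refl|].
        exists y. split; auto. apply clos_tn1_trans in H0. clear -H0.
        induction H0; [now apply rt_step|eapply rt_trans; eauto]. }
      destruct Hu as (u' & Hu' & Hvu).
      assert (v <> r) by (intros ->; eapply Hroot; eauto).
      destruct (Hpar v) as (z & _ & Hz); auto. { destruct Huv. unfold nms. eapply Hlt; eauto. }
      assert (u' = u) as -> by (rewrite <- (Hz u), <- (Hz u'); auto).
      apply IH. clear -Huv Hvu. apply clos_rt_rt1n in Hvu.
      assert (Hg : forall a b, clos_refl_trans_1n nat (Enl A) a b -> forall c, Enl A c a -> clos_trans nat (Enl A) c b).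
      { intros a b Hab. induction Hab; intros c Hc; [now apply t_step|].
        eapply t_trans; [apply t_step; eauto|auto]. }
      eauto. }
  intros v Hc. apply (H v); auto. apply Hreach.
  assert (Hlast : exists u, E A u v).
  { apply clos_trans_tn1 in Hc. inversion Hc; subst;
    match goal with Hx : Enl A _ v |- _ => destruct Hx; eauto end. }
  destruct Hlast. eapply Hlt; eauto.
Qed.

(** Among the first [N + 1] positions a macro-state repeats. As the tree has no other cycle, some
    step in between is a self-loop, its macro-state is a leaf, and the run never leaves it. *)
Lemma depth1_constant (ms : nat -> nat) : depth1_flat A -> (forall i, E A (ms i) (ms (S i))) ->
  (forall i, (ms i < N)%nat) -> exists i, (i <= N)%nat /\ forall k, ms (i + k)%nat = ms i.
Proof.
  intros Hd HE HN.
  assert (Hrep : exists i j, (i < j <= N)%nat /\ ms i = ms j).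
  { apply NNPP. intros Hno.
    assert (Hnd : NoDup (map ms (seq 0 (S N)))).
    { apply NoDup_map_NoDup_ForallPairs; [|apply seq_NoDup].
      intros a b Ha Hb Hab. apply in_seq in Ha, Hb.
      destruct (lt_eq_lt_dec a b) as [[Hl|]|Hl]; auto; exfalso; apply Hno.
      - exists a, b. split; [lia|auto]. - exists b, a. split; [lia|auto]. }
    apply nodup_bounded_length with (n := N) in Hnd.
    - rewrite length_map, length_seq in Hnd. lia.
    - intros x Hx. apply in_map_iff in Hx as (k & <- & _). auto. }
  destruct Hrep as (i & j & Hij & Heq).
  assert (Hself : exists k, (i <= k < j)%nat /\ ms k = ms (S k)).
  { apply NNPP. intros Hno. apply (tree_no_cycle Hd (ms i)). rewrite Heq at 2.
    assert (Hc : forall d, (i + S d <= j)%nat -> clos_trans nat (Enl A) (ms i) (ms (i + S d)%nat)).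
    { induction d; intros Hle.
      - rewrite Nat.add_1_r. apply t_step. split; auto. intros Hs. apply Hno. exists i. split; [lia|auto].
      - apply t_trans with (ms (i + S d)%nat); [apply IHd; lia|].
        rewrite (Nat.add_succ_r i (S d)). apply t_step. split; auto. intros Hs. apply Hno.
        exists (i + S d)%nat. split; [lia|auto]. }
    specialize (Hc (j - i - 1)%nat). replace (i + S (j - i - 1))%nat with j in Hc by lia.
    apply Hc. lia. }
  destruct Hself as (k & Hk & Hkk). exists k. split; [lia|].
  assert (Hkk' : E A (ms k) (ms k)) by (rewrite Hkk at 2; auto).
  destruct Hd as (_ & _ & _ & _ & _ & Hleaf).
  induction k0; [f_equal; lia|]. rewrite Nat.add_succ_r. apply NNPP. intros Hne.
  apply (Hleaf (ms k) Hkk' (ms (S (k + k0)))). split; auto. rewrite <- IHk0. auto.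
Qed.

Lemma bound_formulas_complete m0 w0 U : depth1_flat A -> inf_run A m0 (Q2R w0) (Q2R L) U ->
  exists F, In F (bound_formulas G N m0 w0) /\ sat (env1 U) F.
Proof.
  intros Hd Hrun. apply inf_run_choice in Hrun as (ms & en & P & <- & H0 & HP).
  assert (HN : forall i, (ms i < N)%nat) by (intros i; now apply (ms_bound ms en P U)).
  destruct (depth1_constant ms Hd) as (i & Hi & Hc); auto.
  { intros i. now apply (ms_E ms en P U). }
  assert (Cl := conn_segment ms en P U HP i 1). rewrite Hc in Cl.
  destruct (loopsC_complete N (ms i) (segment ms P i 1)) as (F & HF & RF); auto.
  { discriminate. } { simpl. specialize (HN i). lia. }
  assert (HW : win F (en i) U).
  { apply (win_of_period ms en P U HP i 1); auto. intros k. rewrite <- Nat.add_assoc. now rewrite !Hc. }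
  assert (C0 := conn_segment ms en P U HP 0 i). assert (R0 := run_segment ms en P U HP 0 i).
  simpl plus in C0, R0.
  destruct (pathsC_upto_complete N _ (segment ms P 0 i) _ ltac:(unfold segment; rewrite length_map, length_seq; auto) C0)
    as (F1 & HF1 & RF1).
  exists (boundC w0 F1 F). split.
  - apply in_flat_map. exists (F1, ms i). split; auto. apply in_map_iff. eauto.
  - apply sat_boundC. exists (en i). split; auto. apply RF1. congruence.
Qed.
End Runs.

(** * Correctness and final assembly *)

Lemma Q_above (x : R) : exists q : Q, x <= Q2R q.
Proof.
  exists (inject_Z (up x)). unfold Q2R, inject_Z. simpl.
  destruct (archimed x) as [H _]. lra.
Qed.

Lemma decide_correct A m0 w0 L : WF A -> flat A ->
  decide {| aut := A; init := m0; energy := w0; lower := L |} = true <->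
  exists U : Q, good_ub A m0 w0 L U.
Proof.
  intros HA Hfl. unfold decide. cbn [aut init energy lower]. rewrite existsb_exists. split.
  - intros (F & HF & Hq). apply existsb_exists in Hq as (q & Hq & Hneg).
    apply qpos_opp_spec in Hneg. apply candidates_sound in Hq.
    assert (exists U, inf_run A m0 (Q2R w0) (Q2R L) U) as [U HU].
    { apply in_app_or in HF as [HF|HF].
      - eapply direct_formulas_sound; eauto.
      - eapply boost_formulas_sound; eauto. }
    (* The formulas provide a real bound; any rational above it works by monotonicity. *)
    destruct (Q_above U) as [V HV]. exists V. unfold good_ub. eapply inf_run_mono; eauto.
  - intros [U HU]. destruct (formulas_complete A HA L m0 w0 _ Hfl HU) as (F & t & HF & Hs & Ht).
    exists F. split; auto. apply existsb_exists.
    destruct (candidates_complete F (-1) t) as (q & Hq & Hqt); auto.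
    (* Both families force variable 0 to be at least -1, which ensures that the minimum exists. *)
    { intros s Hs'. apply in_app_or in HF as [HF|HF].
      - apply in_flat_map in HF as [? [_ HF]]. apply in_map_iff in HF as (? & <- & _).
        apply sat_directC in Hs'. lra.
      - apply in_flat_map in HF as [? [_ HF]]. apply in_flat_map in HF as [? [_ HF]].
        apply in_flat_map in HF as [? [_ HF]]. apply in_map_iff in HF as (? & <- & _).
        apply sat_boostC in Hs'. lra. }
    exists q. split; auto. apply qpos_opp_spec. lra.
Qed.

Lemma inf_run_bounds A m w L U : inf_run A m w L U -> L <= U.
Proof.
  intros (ms & en & _ & _ & H). destruct (H 0%nat) as (p & _ & Hr).
  apply etp_run_bounds in Hr. lra.
Qed.

Lemma least_bound_correct A m0 w0 L : WF A -> depth1_flat A -> (exists U : Q, good_ub A m0 w0 L U) ->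
  let V := least_bound {| aut := A; init := m0; energy := w0; lower := L |} in
  good_ub A m0 w0 L V /\ (forall U : Q, good_ub A m0 w0 L U -> (V <= U)%Q).
Proof.
  intros HA Hd Hex V.
  set (cs := flat_map candidates (bound_formulas (graph A L) (length (mstates A)) m0 w0)).
  assert (Hc : forall U : Q, good_ub A m0 w0 L U -> exists q, In q cs /\ Q2R q <= Q2R U).
  { intros U HU. destruct (bound_formulas_complete A HA L m0 w0 _ Hd HU) as (F & HF & Hs).
    destruct (candidates_complete F (Q2R L) (Q2R U)) as (q & Hq & HqU); auto.
    (* Soundness holds for real bounds, and every run starts with an energy between [L] and the
       bound; hence [L] bounds the solutions from below. *)
    { intros s Hs'. eapply bound_formulas_sound in Hs'; eauto. eapply inf_run_bounds; eauto. }
    exists q. split; auto. apply in_flat_map. eauto. }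
  change V with (minQ cs). split.
  - destruct Hex as [U HU]. destruct (Hc U HU) as (q & Hq & _). destruct (minQ_spec _ _ Hq) as [Hm _].
    apply in_flat_map in Hm as (F & HF & Hm). apply candidates_sound in Hm.
    unfold good_ub. eapply bound_formulas_sound; eauto.
  - intros U HU. destruct (Hc U HU) as (q & Hq & HqU). destruct (minQ_spec _ _ Hq) as [_ Hm].
    apply Rle_Qle. lra.
Qed.

Lemma enc_input_code A m0 w0 L :
  enc_input A m0 w0 L = enc {| aut := A; init := m0; energy := w0; lower := L |}.
Proof. reflexivity. Qed.

Theorem mainTheorem6 :
  (* (i) decidability for flat SETA *)
  (exists c : recf,
     forall (A : seta) (m0 : nat) (w0 L : Q),
       WF A -> (m0 < nms A)%nat -> flat A ->
       ((exists U : Q, good_ub A m0 w0 L U) -> eval c [enc_input A m0 w0 L] 1) /\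
       (~ (exists U : Q, good_ub A m0 w0 L U) -> eval c [enc_input A m0 w0 L] 0)) /\
  (* (ii) computability of the least upper bound for depth-1 flat SETA *)
  (exists c : recf,
     forall (A : seta) (m0 : nat) (w0 L : Q),
       WF A -> (m0 < nms A)%nat -> depth1_flat A ->
       (exists U : Q, good_ub A m0 w0 L U) ->
       exists Umin : Q,
         eval c [enc_input A m0 w0 L] (enc_Q Umin) /\
         good_ub A m0 w0 L Umin /\
         (forall U : Q, good_ub A m0 w0 L U -> (Umin <= U)%Q)).
Proof.
  split.
  - destruct Cmp_decide as [g [Hg Eg]].
    (* The answer must be the plain number 0 or 1, so [pi2] removes the tag from the code of the
       Boolean. *)
    destruct (fn_pi2 1 _ Hg) as [c Hc]. exists c. intros A m0 w0 L HA _ Hfl.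
    specialize (Hc [enc_input A m0 w0 L] eq_refl). simpl nth in Hc.
    rewrite enc_input_code, Eg in Hc. rewrite enc_input_code.
    pose proof (decide_correct A m0 w0 L HA Hfl) as Hd.
    unfold enc at 2 in Hc. unfold tocode, Codable_bool in Hc. simpl enc_code in Hc.
    rewrite pi2_cpair in Hc. split; intros Hex.
    + apply Hd in Hex. now rewrite Hex in Hc.
    + destruct (decide _); [tauto|exact Hc].
  - destruct Cmp_least_bound as [g [[c Hc] Eg]]. exists c. intros A m0 w0 L HA _ Hd Hex.
    eexists. split; [|exact (least_bound_correct A m0 w0 L HA Hd Hex)].
    specialize (Hc [enc_input A m0 w0 L] eq_refl). simpl nth in Hc.
    rewrite enc_input_code, Eg in Hc. exact Hc.
Qed.
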